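(* Let $M$ be a tracial W$^*$-algebra and $P\subset M$ a diffuse quasi-regular W$^*$-subalgebra. Then $P\subset M$ is not compressible.
   Context: All inclusions of W$^*$-algebras are unital; tracial means endowed with a faithful normal tracial state. $(X)_1$ is the unit ball of a normed space $X$; $\mathcal U(M)$ the unitary group. Compressible: identify $M$ with $M\otimes 1\subset M\otimes\mathbb M_K(\mathbb C)$. The W$^*$-subalgebra $P\subset M$ is compressible if for every $\varepsilon>0$ there is a finite set $\mathcal U_0\subset\mathcal U(M)$ such that for every $K\ge 1$ and every $x\in (P\otimes\mathbb M_K(\mathbb C))_1$ there is $x_0\in (1\otimes\mathbb M_K(\mathbb C))_1$ with $\big\|\frac1{|\mathcal U_0|}\sum_{u\in\mathcal U_0}uxu^*-x_0\big\|\le\varepsilon$. Quasi-regular: the quasi-normalizer $q\mathcal N_M(P)$ is the set of $x\in M$ such that $\mathrm{sp}(PxP)$ is finitely generated both as a left $P$-module and as a right $P$-module (it is a $^*$-subalgebra of $M$); $P$ is quasi-regular in $M$ if $q\mathcal N_M(P)$ is weakly dense in $M$. *)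

(* Defs.v *)
From HB Require Import structures.
From mathcomp Require Import all_boot all_order all_algebra.
From mathcomp Require Import complex.
From mathcomp Require Import all_classical all_reals all_analysis.

Set Implicit Arguments.
Unset Strict Implicit.
Unset Printing Implicit Defensive.

Import Order.TTheory GRing.Theory Num.Theory.
Import numFieldNormedType.Exports.

Local Open Scope classical_set_scope.
Local Open Scope ring_scope.

(* A complex Hilbert space is a complete normed space H over R[i] with a
   positive definite form dot, linear in its first argument, that induces the
   norm.  W*-algebras are represented as von Neumann algebras on such an H, as
   sets of functions H -> H; the linear structure on H -> H is pointwise and
   the product is composition. *)

Section Operators.
Variables (R : realType) (H : completeNormedModType R[i]).
Variable dot : {dot H for (@Num.conj R[i])}.
Implicit Types (A M P : set (H -> H)) (T S : H -> H).

Definition hilbert_norm := forall xi : H, `|xi| ^+ 2 = dot xi xi.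

Definition bounded_operator T := linear T /\ continuous T.

Definition is_adjoint T S := forall xi eta, dot (T xi) eta = dot xi (S eta).

(* The default value 0 is never used on bounded operators of a Hilbert space. *)
Definition adj T : H -> H := xget 0 [set S | is_adjoint T S].

Definition commutant A : set (H -> H) :=
  [set T | bounded_operator T /\ forall S, A S -> T \o S = S \o T].

(* Being a commutant, a von Neumann algebra consists of bounded operators, is a
   subalgebra and contains idfun; hence an inclusion of two of them is
   unital. *)
Definition von_neumann_algebra M :=
  commutant (commutant M) = M /\
  forall T, M T -> exists2 S, M S & is_adjoint T S.

Definition square_summable (xi : nat -> H) :=
  cvgn (series (fun n => `|xi n| ^+ 2 : R[i]^o)).

(* The elements of the predual of M, i.e. the restrictions to M of the
   functionals T |-> \sum_n <T xi_n, eta_n>. *)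
Definition normal M (phi : (H -> H) -> R[i]) :=
  exists xi eta : nat -> H,
    [/\ square_summable xi, square_summable eta &
        forall T, M T ->
          series (fun n => dot (T (xi n)) (eta n) : R[i]^o) @ \oo --> (phi T : R[i]^o)].

(* Density for the weak topology induced on M by its predual. *)
Definition weakly_dense A M :=
  A `<=` M /\
  forall T, M T -> forall (s : seq ((H -> H) -> R[i])) (e : R[i]), 0 < e ->
    (forall phi, phi \in s -> normal M phi) ->
    exists2 S, A S & forall phi, phi \in s -> `|phi T - phi S| < e.

(* Only the values of tau on M matter. *)
Definition faithful_normal_tracial_state M (tau : (H -> H) -> R[i]) :=
  [/\ forall (a : R[i]) T S, M T -> M S -> tau (a *: T + S) = a * tau T + tau S,
      forall T, M T -> 0 <= tau (adj T \o T) & tau idfun = 1] /\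
  [/\ forall T, M T -> tau (adj T \o T) = 0 -> T = 0,
      normal M tau &
      forall T S, M T -> M S -> tau (T \o S) = tau (S \o T)].

Definition projection T := is_adjoint T T /\ T \o T = T.

Definition operator_le T S := forall xi, 0 <= dot ((S - T) xi) xi.

Definition minimal_projection P p :=
  [/\ P p, projection p, p <> 0 &
      forall q, P q -> projection q -> operator_le q p -> q = 0 \/ q = p].

Definition diffuse P := ~ exists p, minimal_projection P p.

Definition lin_span A : set (H -> H) :=
  [set T | exists s : seq (R[i] * (H -> H)),
     (forall z, z \in s -> A z.2) /\ T = \sum_(z <- s) z.1 *: z.2].

Definition bimodule_span P T : set (H -> H) :=
  lin_span [set Y | exists a b, [/\ P a, P b & Y = a \o T \o b]].

Definition left_finitely_generated P (N : set (H -> H)) :=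
  exists (n : nat) (g : 'I_n -> H -> H),
    N = [set T | exists a : 'I_n -> H -> H,
           (forall i, P (a i)) /\ T = \sum_i (a i \o g i)].

Definition right_finitely_generated P (N : set (H -> H)) :=
  exists (n : nat) (g : 'I_n -> H -> H),
    N = [set T | exists a : 'I_n -> H -> H,
           (forall i, P (a i)) /\ T = \sum_i (g i \o a i)].

Definition quasi_normalizer M P : set (H -> H) :=
  [set T | [/\ M T, left_finitely_generated P (bimodule_span P T) &
                    right_finitely_generated P (bimodule_span P T)]].

Definition quasi_regular M P := weakly_dense (quasi_normalizer M P) M.

Definition unitary_group M : set (H -> H) :=
  [set U | [/\ M U, adj U \o U = idfun & U \o adj U = idfun]].

(* B(H) (x) M_K(C) is the algebra of K x K matrices over B(H), acting on the
   Hilbert sum of K copies of H. *)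
Definition l2_norm K (xi : 'I_K -> H) : R[i] := sqrtC (\sum_i `|xi i| ^+ 2).

Definition mx_apply K (X : 'M[H -> H]_K) (xi : 'I_K -> H) : 'I_K -> H :=
  fun i => \sum_j X i j (xi j).

Definition opnorm_le K (X : 'M[H -> H]_K) (c : R[i]) :=
  forall xi : 'I_K -> H, l2_norm (mx_apply X xi) <= c * l2_norm xi.

Definition unit_ball K (N : set 'M[H -> H]_K) : set 'M[H -> H]_K :=
  [set X | N X /\ opnorm_le X 1].

Definition tensor_mx P K : set 'M[H -> H]_K :=
  [set X | forall i j, P (X i j)].

(* 1 (x) M_K(C) *)
Definition scalar_mxs K : set 'M[H -> H]_K :=
  [set X | exists c : 'M[R[i]]_K, forall i j, X i j = c i j *: (idfun : H -> H)].

(* (1/|U0|) \sum_(u in U0) u X u^*, where u stands for u (x) 1, which acts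
   entrywise. *)
Definition conj_average (U0 : seq (H -> H)) K (X : 'M[H -> H]_K) :
    'M[H -> H]_K :=
  \matrix_(i, j)
    ((size U0)%:R^-1 *: \sum_(u <- U0) (u \o X i j \o adj u : H -> H)).

(* The finite set U0 is a nonempty duplicate-free sequence: for the empty one
   the average would be 1/0 times an empty sum, that is 0. *)
Definition compressible M P :=
  forall e : R[i], 0 < e ->
    exists U0 : seq (H -> H),
      [/\ uniq U0, (0 < size U0)%N, forall u, u \in U0 -> unitary_group M u &
        forall (K : nat) (X : 'M[H -> H]_K), (0 < K)%N ->
          unit_ball (tensor_mx P (K := K)) X ->
          exists2 X0, unit_ball (@scalar_mxs K) X0 &
                      opnorm_le (conj_average U0 X - X0) e].

End Operators.

(* Main.v *)
(* Matrix amplification is not needed: [K = 1] already fails.  Take the unitaries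
   [u_1, ..., u_n] given by compressibility for [1/8], and approximate each [u_k]
   in 2-norm by an [x_k] with [P x_k] contained in [sum_j g_kj P], [m] generators
   in all.  If [f_1, ..., f_r] are orthogonal projections of [P], the right
   [P]-modules generated by [(f_i x_k)_k] are mutually orthogonal, so additivity of
   the dimension over [P] bounds the sum of the traces of their right supports
   [z_i] by [m], whatever [r] is.  As [P] is diffuse the [f_i] can be taken so
   small that, by the pigeonhole principle, some [f = f_i] and [z = z_i] satisfy
   [tr z <= 1/8] while [f u_k z] is close to [f u_k], relatively to [tr f], for
   all [k].  Then [tr (f a) >= 5/8 tr f] for the average [a] of the
   [u_k z u_k^*], although compressibility puts [a] within [1/4] of [tr z].

   The dimension estimate is made without supports: if [f_i x_k] is
   [sum_j g_kj p_(kj)i] with [p] a contractive matrix over [P], take for [z_i]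
   the diagonal entries of [1 - (1 - q p)^N], with [q] the adjoint of [p].  Their
   traces have the same sum as for [1 - (1 - p q)^N], an [m x m] matrix, hence at
   most [m]; and [(1 - q p)^N] tends strongly to the projection on the kernel of
   [p], which every [f_i x_k] annihilates. *)

Require Import Defs.
From HB Require Import structures.
From mathcomp Require Import all_boot all_order all_algebra.
From mathcomp Require Import complex.
From mathcomp Require Import all_classical all_reals all_analysis.
From mathcomp Require Import ring lra.

Import Order.TTheory GRing.Theory Num.Theory.
Import numFieldNormedType.Exports.

Local Open Scope classical_set_scope.
Local Open Scope ring_scope.

Set Implicit Arguments.
Unset Strict Implicit.
Unset Printing Implicit Defensive.

(** * Real inner product of a complex Hilbert space *)

Section RealHilbert.
Context (R : realType) (H : completeNormedModType R[i]).
Variable dot : {dot H for (@Num.conj R[i])}.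
Hypothesis hdot : hilbert_norm dot.
Implicit Types (x y z : H) (a : R).

(** The real part of [dot] is a symmetric real inner product inducing the same norm, so that
    estimates and limits take place in [R]. *)
Definition re_dot x y : R := complex.Re (dot x y).
Definition sqr_norm x : R := re_dot x x.
Notation rdot := re_dot.
Notation nrm2 := sqr_norm.

Lemma Re_realM a (z : R[i]) : complex.Re (a%:C%C * z) = a * complex.Re z.
Proof. by case: z => u v /=; rewrite mul0r subr0. Qed.

Lemma rdotDl x y z : rdot (x + y) z = rdot x z + rdot y z.
Proof. by rewrite /re_dot linearDl raddfD. Qed.

Lemma rdotNl x z : rdot (- x) z = - rdot x z.
Proof. by rewrite /re_dot linearNl raddfN. Qed.

Lemma rdotZl a x z : rdot (a%:C%C *: x) z = a * rdot x z.
Proof. by rewrite /re_dot linearZl_LR Re_realM. Qed.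

Lemma rdotC x y : rdot x y = rdot y x.
Proof. by rewrite /re_dot hermC /= expr0 mul1r; case: (dot y x). Qed.

Lemma rdotDr x y z : rdot z (x + y) = rdot z x + rdot z y.
Proof. by rewrite !(rdotC z) rdotDl. Qed.

Lemma rdotNr x z : rdot z (- x) = - rdot z x.
Proof. by rewrite !(rdotC z) rdotNl. Qed.

Lemma rdotZr a x z : rdot z (a%:C%C *: x) = a * rdot z x.
Proof. by rewrite !(rdotC z) rdotZl. Qed.

Lemma rdot0l z : rdot 0 z = 0.
Proof. by rewrite /re_dot linear0l. Qed.

Lemma nrm2E x : `|x| ^+ 2 = (nrm2 x)%:C%C.
Proof.
rewrite hdot /sqr_norm /re_dot RRe_real // -hdot.
by rewrite realE exprn_ge0.
Qed.

Lemma nrm2_ge0 x : 0 <= nrm2 x.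
Proof. by rewrite -lecR -nrm2E exprn_ge0. Qed.

Lemma nrm2_eq0 x : nrm2 x = 0 -> x = 0.
Proof.
move=> h; have := nrm2E x; rewrite h => /eqP; rewrite expf_eq0 /= normr_eq0.
by move/eqP.
Qed.

Lemma nrm20 : nrm2 0 = 0. Proof. exact: rdot0l. Qed.

Lemma nrm2N x : nrm2 (- x) = nrm2 x.
Proof. by rewrite /sqr_norm rdotNl rdotNr opprK. Qed.

Lemma nrm2Z a x : nrm2 (a%:C%C *: x) = a ^+ 2 * nrm2 x.
Proof. by rewrite /sqr_norm rdotZl rdotZr mulrA. Qed.

Lemma nrm2D x y : nrm2 (x + y) = nrm2 x + 2 * rdot x y + nrm2 y.
Proof. by rewrite /sqr_norm rdotDl !rdotDr (rdotC y x); ring. Qed.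

Lemma nrm2B x y : nrm2 (x - y) = nrm2 x - 2 * rdot x y + nrm2 y.
Proof. by rewrite nrm2D nrm2N rdotNr; ring. Qed.

(** Parallelogram law with the term in [x - y] dropped. *)
Lemma nrm2D_le x y : nrm2 (x + y) <= 2 * (nrm2 x + nrm2 y).
Proof. by have := nrm2_ge0 (x - y); rewrite nrm2B nrm2D; lra. Qed.

Lemma nrm2_sqrt x : `|x| = (Num.sqrt (nrm2 x))%:C%C.
Proof.
apply/eqP; rewrite -(@eqrXn2 _ 2) // ?lecR ?sqrtr_ge0 //.
by rewrite -rmorphXn /= sqr_sqrtr ?nrm2_ge0 // nrm2E.
Qed.

Lemma nrm2_le_norm x a : 0 <= a -> (`|x| <= a%:C%C) = (nrm2 x <= a ^+ 2).
Proof.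
move=> a0; rewrite nrm2_sqrt lecR -[in LHS](ger0_norm a0) -sqrtr_sqr.
by rewrite ler_sqrt // sqr_ge0.
Qed.

(** The source of Cauchy-Schwarz, isolated because it also serves for sequences and for
    near-minimizers of a distance. *)
Lemma discriminant_le (q b d : R) : 0 <= q ->
  (forall s : R, 0 <= d - 2 * s * b + s ^+ 2 * q) -> b ^+ 2 <= d * q.
Proof.
move=> q0 h; have [q00|qn0] := eqVneq q 0.
  rewrite q00 in h *.
  have [->|bn0] := eqVneq b 0; first by rewrite expr0n mulr0.
  (* For [q = 0] the polynomial is affine in [s] and takes the value [-1] here. *)
  have := h ((d + 1) / (2 * b)).
  have -> : 2 * ((d + 1) / (2 * b)) * b = d + 1 by field.
  by rewrite mulr0 => ?; exfalso; lra.
have q1 : 0 < q by rewrite lt_neqAle eq_sym qn0.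
have := h (b / q).
have -> : d - 2 * (b / q) * b + (b / q) ^+ 2 * q = (d * q - b ^+ 2) / q by field.
by rewrite pmulr_lge0 ?invr_gt0 // subr_ge0.
Qed.

Lemma rdot_CS x y : rdot x y ^+ 2 <= nrm2 x * nrm2 y.
Proof.
apply: discriminant_le (nrm2_ge0 y) _ => s.
by have := nrm2_ge0 (x - s%:C%C *: y); rewrite nrm2B nrm2Z rdotZr; lra.
Qed.

(** Cruder than Cauchy-Schwarz, but additive in the squared norms: it makes series of inner products
    converge absolutely. *)
Lemma rdot_le x y : `|rdot x y| <= nrm2 x + nrm2 y.
Proof.
have := nrm2_ge0 (x - y); have := nrm2_ge0 (x + y).
have := nrm2_ge0 x; have := nrm2_ge0 y.
rewrite nrm2B nrm2D ler_norml => *; apply/andP; split; lra.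
Qed.

Lemma hilbert_complete (u : nat -> H) :
    (forall e : R, 0 < e -> exists N, forall m n, (N <= m)%N -> (N <= n)%N ->
       nrm2 (u m - u n) <= e) ->
  exists l, nrm2 (u n - l) @[n --> \oo] --> (0 : R).
Proof.
move=> h.
have Cu : cvg (u @ \oo).
  apply/cauchy_cvgP/cauchyP => /= e e0.
  have e1 : 0 < complex.Re e by move: e0; rewrite ltcE => /andP[].
  have eE : e = (complex.Re e)%:C%C.
    by rewrite RRe_real // realE (ltW e0).
  have [|N hN] := h ((complex.Re e / 2) ^+ 2); first by rewrite exprn_gt0 ?divr_gt0.
  exists (u N); exists N => // n /= Nn; rewrite -ball_normE /=.
  apply: (@le_lt_trans _ _ ((complex.Re e / 2)%:C%C)).
    by rewrite nrm2_le_norm ?hN // ltW // divr_gt0.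
  by rewrite [ltRHS]eE ltcR ltr_pdivrMr // ltr_pMr // ltr1n.
have /cvg_ex [l ul] := Cu.
exists l; apply/cvgrPdist_le => /= e e0.
have s0 : 0 < (Num.sqrt e)%:C%C :> R[i] by rewrite ltcR sqrtr_gt0.
move/cvgrPdist_le : ul => /(_ _ s0) [N _ hN]; exists N => // n /= Nn.
rewrite sub0r normrN ger0_norm ?nrm2_ge0 //.
have := hN n Nn; rewrite nrm2_le_norm ?sqrtr_ge0 // sqr_sqrtr ?(ltW e0) //.
by rewrite -nrm2N opprB.
Qed.

Lemma bounded_operator_nrm2 (T : H -> H) : bounded_operator T ->
  exists2 C, 0 <= C & forall x, nrm2 (T x) <= C * nrm2 x.
Proof.
move=> [lT cT].
pose lin := GRing.isLinear.Build _ _ _ _ T lT.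
pose T' : {linear H -> H} := HB.pack T lin.
have /linear_bounded_continuous : continuous T' by [].
move/linear_boundedP => [M [Mr hM]].
pose c := `|complex.Re M| + 1.
have c0 : 0 < c by rewrite ltr_wpDl.
exists (c ^+ 2) => [|x]; first exact: sqr_ge0.
have Mc : M < c%:C%C.
  by rewrite -(RRe_real Mr) ltcR (le_lt_trans (ler_norm _)) // ltrDl.
have := hM _ Mc x; rewrite [`|x|]nrm2_sqrt -rmorphM /= nrm2_le_norm.
  by rewrite exprMn sqr_sqrtr ?nrm2_ge0.
by rewrite mulr_ge0 ?sqrtr_ge0 ?ltW.
Qed.

Lemma nrm2_bounded_operator (T : H -> H) (C : R) : linear T ->
  (forall x, nrm2 (T x) <= C * nrm2 x) -> bounded_operator T.
Proof.
move=> lT hC; split => //.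
pose lin := GRing.isLinear.Build _ _ _ _ T lT.
pose T' : {linear H -> H} := HB.pack T lin.
suff /linear_bounded_continuous : bounded_near T' (nbhs (0 : H)) by [].
apply/linear_boundedP; exists (Num.sqrt `|C|)%:C%C; split.
  by rewrite realE lecR sqrtr_ge0.
move=> c hc x; have c0 : 0 <= c by apply: le_trans (ltW hc); rewrite lecR sqrtr_ge0.
have cE : c = (complex.Re c)%:C%C by rewrite RRe_real // realE c0.
move: c0 hc; rewrite cE lecR ltcR => c0 hc.
rewrite [`|x|]nrm2_sqrt -rmorphM /= nrm2_le_norm ?mulr_ge0 ?sqrtr_ge0 //.
rewrite exprMn sqr_sqrtr ?nrm2_ge0 //; apply: le_trans (hC x) _.
rewrite ler_wpM2r ?nrm2_ge0 //; apply: le_trans (ler_norm C) _.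
by rewrite -[leLHS]sqr_sqrtr // lerXn2r ?nnegrE ?sqrtr_ge0 // ltW.
Qed.

Lemma nrm2_scale_le (a : R[i]) : exists2 C, 0 <= C & forall x, nrm2 (a *: x) <= C * nrm2 x.
Proof.
have [c cE] : exists c : R, `|a| ^+ 2 = c%:C%C.
  by exists (complex.Re (`|a| ^+ 2)); rewrite RRe_real // realE exprn_ge0.
exists c => [|x]; first by rewrite -lecR -cE exprn_ge0.
by rewrite -lecR rmorphM /= -!nrm2E -cE normrZ exprMn.
Qed.

End RealHilbert.

(** * Matrices over a tracial star-ring *)

Section MatrixTrace.
Context (R : realType) (A : pzRingType) (star : A -> A) (t : A -> R).
Hypotheses (starD : {morph star : x y / x + y})
  (starM : forall x y, star (x * y) = star y * star x)
  (starK : involutive star) (star1 : star 1 = 1).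
Hypotheses (tD : {morph t : x y / x + y}) (tC : forall x y, t (x * y) = t (y * x))
  (t_ge0 : forall x, 0 <= t (star x * x)) (t1 : t 1 = 1).

Let star0 : star 0 = 0.
Proof. by apply: (@addrI _ (star 0)); rewrite -starD !addr0. Qed.

Let t0 : t 0 = 0.
Proof. by apply: (@addrI _ (t 0)); rewrite -tD !addr0. Qed.

Let star_sum I (s : seq I) (F : I -> A) : star (\sum_(i <- s) F i) = \sum_(i <- s) star (F i).
Proof. exact: big_morph. Qed.

Let t_sum I (s : seq I) (F : I -> A) : t (\sum_(i <- s) F i) = \sum_(i <- s) t (F i).
Proof. exact: big_morph. Qed.

Definition star_mx m n (X : 'M[A]_(m, n)) : 'M[A]_(n, m) :=
  \matrix_(i, j) star (X j i).

Lemma star_mxM m n l (X : 'M[A]_(m, n)) (Y : 'M[A]_(n, l)) :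
  star_mx (X *m Y) = star_mx Y *m star_mx X.
Proof.
apply/matrixP => i j; rewrite !mxE star_sum; apply: eq_bigr => k _.
by rewrite starM !mxE.
Qed.

Lemma star_mxK m n (X : 'M[A]_(m, n)) : star_mx (star_mx X) = X.
Proof. by apply/matrixP => i j; rewrite !mxE starK. Qed.

Lemma star_mx1 n : star_mx (1 : 'M[A]_n) = 1.
Proof.
by apply/matrixP => i j; rewrite !mxE eq_sym; case: eqP => _; rewrite ?star1 ?star0.
Qed.

Lemma star_mxB m n (X Y : 'M[A]_(m, n)) : star_mx (X - Y) = star_mx X - star_mx Y.
Proof.
have starN x : star (- x) = - star x.
  by apply: (@addrI _ (star x)); rewrite -starD !subrr.
by apply/matrixP => i j; rewrite !mxE starD starN.
Qed.

Lemma star_mxX n (X : 'M[A]_n) k : star_mx X = X -> star_mx (X ^+ k) = X ^+ k.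
Proof.
move=> hX; elim: k => [|k IH]; first by rewrite expr0 star_mx1.
by rewrite [in LHS]exprS exprSr (star_mxM X (X ^+ k)) IH hX.
Qed.

(** Unnormalized, so that the identity of size [m] has trace [m]; this becomes the bound on the
    dimension. *)
Definition mx_tr n (X : 'M[A]_n) : R := \sum_i t (X i i).

Lemma mx_trD n (X Y : 'M[A]_n) : mx_tr (X + Y) = mx_tr X + mx_tr Y.
Proof. by rewrite -big_split; apply: eq_bigr => i _; rewrite mxE tD. Qed.

Lemma mx_trB n (X Y : 'M[A]_n) : mx_tr (X - Y) = mx_tr X - mx_tr Y.
Proof. by apply: (@addIr _ (mx_tr Y)); rewrite -mx_trD !subrK. Qed.

Lemma mx_tr1 n : mx_tr (1 : 'M[A]_n) = n%:R.
Proof.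
rewrite /mx_tr (eq_bigr (fun=> 1)) ?sumr_const ?card_ord // => i _.
by rewrite mxE eqxx.
Qed.

Lemma mx_trC m n (X : 'M[A]_(m, n)) (Y : 'M[A]_(n, m)) :
  mx_tr (X *m Y) = mx_tr (Y *m X).
Proof.
rewrite /mx_tr (eq_bigr (fun i => \sum_j t (X i j * Y j i))); last first.
  by move=> i _; rewrite mxE t_sum.
rewrite exchange_big; apply: eq_bigr => i _; rewrite mxE t_sum.
by apply: eq_bigr => j _; rewrite tC.
Qed.

Lemma mx_tr_ge0 m n (X : 'M[A]_(m, n)) : 0 <= mx_tr (star_mx X *m X).
Proof.
apply: sumr_ge0 => i _; rewrite mxE t_sum; apply: sumr_ge0 => j _.
by rewrite mxE t_ge0.
Qed.

(** Since [p (q p) = (p q) p], the matrix [p] intertwines polynomials in [q p] and in [p q]. *)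
Lemma mx_intertwine m r (p : 'M[A]_(m, r)) (q : 'M[A]_(r, m)) k :
  p *m (1 - q *m p) ^+ k = (1 - p *m q) ^+ k *m p.
Proof.
elim: k => [|k IH]; first by rewrite !expr0 mulmx1 mul1mx.
have E : p *m (1 - q *m p) = (1 - p *m q) *m p.
  by rewrite mulmxBr mulmxBl mulmx1 mul1mx mulmxA.
by rewrite exprS (mulmxA p (1 - q *m p)) E -mulmxA IH mulmxA [in RHS]exprS.
Qed.

(** [1 - (1 - a)^k] is the sum of the [a (1 - a)^j] for [j < k]. For [a = q p], intertwining and
    cycling the factors under the trace give the corresponding term for [p q], a matrix of another
    size. *)
Lemma mx_tr_swap m r (p : 'M[A]_(m, r)) (q : 'M[A]_(r, m)) k :
  mx_tr (1 - (1 - q *m p) ^+ k) = mx_tr (1 - (1 - p *m q) ^+ k).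
Proof.
elim: k => [|k IH]; first by rewrite !expr0 !mx_trB !subrr.
have E n (a : 'M[A]_n) : 1 - (1 - a) ^+ k.+1 = (1 - (1 - a) ^+ k) + a *m (1 - a) ^+ k.
  by rewrite exprS mulrBl mul1r opprB addrCA addrC -[a * _]/(a *m _).
rewrite !E [LHS]mx_trD [RHS]mx_trD IH; congr (_ + _).
by rewrite -mulmxA mx_intertwine mx_trC -mulmxA mx_trC.
Qed.

(** After the swap, the even power is the product of the adjoint of [b^k] with [b^k], so its trace
    is nonnegative and the size [m] of the identity remains, whatever [r] is. *)
Lemma mx_tr_le m r (p : 'M[A]_(m, r)) k :
  mx_tr (1 - (1 - star_mx p *m p) ^+ k.*2) <= m%:R.
Proof.
rewrite mx_tr_swap mx_trB mx_tr1 gerBl.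
set b := 1 - _; have hb : star_mx b = b.
  by rewrite /b star_mxB star_mx1 star_mxM star_mxK.
by rewrite -addnn exprD -{1}(star_mxX k hb) mx_tr_ge0.
Qed.

End MatrixTrace.

(** * Null sequences of real numbers *)

Section NullSequences.
Context (R : realType).
Implicit Types (c : R) (u v : nat -> R).

(** Used to show that a vector or an operator vanishes: its squared norm is bounded by each term of
    a null sequence. *)
Lemma le_cvg0 c u : (forall n, c <= u n) -> u n @[n --> \oo] --> 0 -> c <= 0.
Proof. by move=> h hu; apply: (ler_cvg_to (cvg_cst c) hu); exists 0%N => // n _; exact: h. Qed.

Lemma squeeze0 u v : (forall n, 0 <= u n <= v n) ->
  v n @[n --> \oo] --> 0 -> u n @[n --> \oo] --> 0.
Proof.
move=> h; apply: (squeeze_cvgr _ (cvg_cst 0)); exists 0%N => // n _; exact: h.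
Qed.

Lemma nullM c u : u n @[n --> \oo] --> 0 -> c * u n @[n --> \oo] --> 0.
Proof. by move=> h; rewrite -[X in _ --> X](mulr0 c); exact: cvgM (cvg_cst c) h. Qed.

Lemma nullD u v : u n @[n --> \oo] --> 0 -> v n @[n --> \oo] --> 0 ->
  u n + v n @[n --> \oo] --> 0.
Proof. by move=> hu hv; rewrite -[X in _ --> X](addr0 0); exact: cvgD hu hv. Qed.

Lemma null_sum I (r : seq I) (F : I -> nat -> R) :
  (forall i, F i n @[n --> \oo] --> 0) -> \sum_(i <- r) F i n @[n --> \oo] --> 0.
Proof.
move=> hF; elim: r => [|i r IH].
  by under eq_cvg do rewrite big_nil; exact: cvg_cst.
by under eq_cvg do rewrite big_cons; exact: nullD.
Qed.

End NullSequences.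

(** * Von Neumann algebras as tracial star-rings *)

Section VonNeumann.
Context (R : realType) (H : completeNormedModType R[i]).
Variable dot : {dot H for (@Num.conj R[i])}.
Hypothesis hdot : hilbert_norm dot.
Implicit Types (S T : H -> H).
Notation nrm2 := (sqr_norm dot).

Lemma boundedD S T : bounded_operator S -> bounded_operator T -> bounded_operator (S + T).
Proof.
move=> [lS cS] [lT cT]; split=> [a x y|x].
  by rewrite !fctE lS lT scalerDr addrACA.
exact: (cvgD (cS x) (cT x)).
Qed.

Lemma boundedZ a S : bounded_operator S -> bounded_operator (a *: S).
Proof.
move=> [lS cS]; split=> [b x y|x].
  by rewrite !fctE lS scalerDr !scalerA mulrC.
exact: (@cvgZ _ _ _ _ _ (cst a) S a (S x) (cvg_cst a) (cS x)).
Qed.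

Lemma bounded_comp S T : bounded_operator S -> bounded_operator T -> bounded_operator (S \o T).
Proof.
move=> [lS cS] [lT cT]; split=> [a x y|x] /=; first by rewrite lT lS.
exact: continuous_comp (cT x) (cS (T x)).
Qed.

Lemma bounded_id : bounded_operator (idfun : H -> H).
Proof. by split=> // x; exact: cvg_id. Qed.

Lemma is_adjoint_unique T S S' : is_adjoint dot T S -> is_adjoint dot T S' -> S = S'.
Proof.
move=> h h'; apply/funext => x; apply/eqP; rewrite -subr_eq0; apply/eqP.
apply: (nrm2_eq0 hdot); rewrite /sqr_norm /re_dot linearBr.
by rewrite /= -h -h' subrr.
Qed.

(** By uniqueness, the chosen adjoint agrees with any adjoint at hand. *)
Lemma adjP T S : is_adjoint dot T S -> adj dot T = S.
Proof. by move=> h; apply: (is_adjoint_unique _ h); rewrite /adj; case: xgetP => // /(_ S). Qed.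

Lemma is_adjoint_sym T S : is_adjoint dot T S -> is_adjoint dot S T.
Proof.
move=> h x y; rewrite hermC [RHS]hermC /= expr0 !mul1r; congr (_^*).
by rewrite h.
Qed.

Section Closure.
Variable M : set (H -> H).
Hypothesis hM : von_neumann_algebra dot M.

Lemma vn_bounded T : M T -> bounded_operator T.
Proof. by rewrite -hM.1 => -[]. Qed.

(** The way operators are put into [M]: sums, multiples, products and strong limits are checked
    below to commute with the commutant. *)
Lemma vn_bicommutant T : bounded_operator T ->
  (forall S, commutant M S -> T \o S = S \o T) -> M T.
Proof. by move=> bT h; rewrite -hM.1. Qed.

Lemma vn_commute T S : M T -> commutant M S -> T \o S = S \o T.
Proof. by move=> MT [_ h]; rewrite h. Qed.

Lemma vnD S T : M S -> M T -> M (S + T).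
Proof.
move=> MS MT; apply: vn_bicommutant => [|U MU]; first by apply: boundedD; exact: vn_bounded.
apply/funext => x; have [[lU _] _] := MU.
rewrite /= !fctE (_ : U (_ + _) = U (S x) + U (T x)).
  by congr (_ + _); [have := vn_commute MS MU|have := vn_commute MT MU] => /(congr1 (@^~ x)).
by rewrite -[S x]scale1r lU !scale1r.
Qed.

Lemma vnZ a T : M T -> M (a *: T).
Proof.
move=> MT; apply: vn_bicommutant => [|U MU]; first by apply: boundedZ; exact: vn_bounded.
apply/funext => x; have [[lU _] _] := MU.
change (a *: T (U x) = U (a *: T x)).
have /= -> := congr1 (@^~ x) (vn_commute MT MU).
have U0 : U 0 = 0 by rewrite -[X in U X](addr0 0) -[X in U (X + _)](scaler0 _ (-1)) lU scaleN1r addNr.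
by rewrite -[a *: _]addr0 -[X in _ + X]U0 -lU addr0.
Qed.

Lemma vnN T : M T -> M (- T).
Proof. by move=> MT; rewrite -scaleN1r; exact: vnZ. Qed.

Lemma vn_comp S T : M S -> M T -> M (S \o T).
Proof.
move=> MS MT; apply: vn_bicommutant => [|U MU]; first by apply: bounded_comp; exact: vn_bounded.
by rewrite -compA (vn_commute MT MU) compA (vn_commute MS MU).
Qed.

Lemma vn_id : M idfun.
Proof. by apply: vn_bicommutant => //; exact: bounded_id. Qed.

Lemma vn0 : M 0.
Proof. by rewrite -(scale0r idfun); exact: vnZ vn_id. Qed.

Lemma vn_is_adjoint T : M T -> is_adjoint dot T (adj dot T).
Proof. by move=> /hM.2[S _ h]; rewrite (adjP h). Qed.

Lemma vn_adj T : M T -> M (adj dot T).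
Proof. by move=> /hM.2[S MS h]; rewrite (adjP h). Qed.

(** [L U x - U L x] is split at [T n (U x) = U (T n x)]; both differences tend to [0] because [U] is
    bounded. *)
Lemma vn_strong_limit (T : nat -> H -> H) (L : H -> H) : (forall n, M (T n)) ->
  bounded_operator L ->
  (forall x, nrm2 (T n x - L x) @[n --> \oo] --> (0 : R)) -> M L.
Proof.
move=> MT bL hT; apply: vn_bicommutant => // U MU; apply/funext => x /=.
have [bU _] := MU; have [lU _] := bU.
have [C C0 hC] := bounded_operator_nrm2 hdot bU.
apply/eqP; rewrite -subr_eq0; apply/eqP/(nrm2_eq0 hdot).
have UB y z : U (y - z) = U y - U z.
  by rewrite addrC -scaleN1r lU scaleN1r addrC.
apply/eqP; rewrite eq_le (nrm2_ge0 hdot) andbT.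
have h n : nrm2 (L (U x) - U (L x)) <=
    2 * (nrm2 (T n (U x) - L (U x)) + C * nrm2 (T n x - L x)).
  apply: (@le_trans _ _ (2 * (nrm2 (T n (U x) - L (U x)) + nrm2 (U (T n x - L x))))).
    rewrite -(nrm2N _ (T n (U x) - _)) opprB UB.
    have /(congr1 (@^~ x)) /= <- := vn_commute (MT n) MU.
    apply: le_trans (nrm2D_le hdot _ _).
    by rewrite addrA subrK.
  by rewrite ler_pM2l // lerD2l.
by apply: le_cvg0 h _; apply: nullM; apply: nullD => //; exact: nullM.
Qed.

End Closure.
End VonNeumann.

(** * The ring of operators of a von Neumann algebra *)

Section OperatorRing.
Context (R : realType) (H : completeNormedModType R[i]).
Variable dot : {dot H for (@Num.conj R[i])}.
Variable M : set (H -> H).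
Hypothesis hM : von_neumann_algebra dot M.

(** The proof [hM] is an argument of the predicate, so that the closure properties can be attached
    to it as an instance. *)
Definition vn_mem of von_neumann_algebra dot M : pred (H -> H) :=
  fun T => `[< M T >].

Record vn_op := VnOp { vn_val :> H -> H; vn_opP : vn_mem hM vn_val }.

HB.instance Definition _ := [isSub for vn_val].
HB.instance Definition _ := [Choice of vn_op by <:].

Lemma vn_zmod_closed : zmod_closed (vn_mem hM).
Proof.
split=> [|S T /asboolP MS /asboolP MT]; apply/asboolP; first exact: vn0 hM.
exact: vnD hM _ _ MS (vnN hM MT).
Qed.

HB.instance Definition _ := GRing.isZmodClosed.Build (H -> H) (vn_mem hM) vn_zmod_closed.
HB.instance Definition _ := [SubChoice_isSubZmodule of vn_op by <:].

Lemma vn_in (T : vn_op) : M T. Proof. by apply/asboolP; exact: vn_opP. Qed.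

Definition to_vn (T : H -> H) (h : M T) : vn_op := VnOp (introT (asboolP _) h).

Lemma vn_ext (S T : vn_op) : (S : H -> H) =1 T -> S = T.
Proof. by move=> h; apply: val_inj; apply/funext. Qed.

Lemma vn_bdd (T : vn_op) : bounded_operator (T : H -> H).
Proof. exact: vn_bounded hM _ (vn_in T). Qed.

Lemma vn_linear (T : vn_op) : linear T.
Proof. by have [] := vn_bdd T. Qed.

Definition vn_mul (S T : vn_op) := to_vn (vn_comp hM (vn_in S) (vn_in T)).
Definition vn_one := to_vn (vn_id hM).

Lemma vn_mulA : associative vn_mul. Proof. by move=> S T U; exact: vn_ext. Qed.
Lemma vn_mul1 : left_id vn_one vn_mul. Proof. by move=> T; exact: vn_ext. Qed.
Lemma vn_mulr1 : right_id vn_one vn_mul. Proof. by move=> T; exact: vn_ext. Qed.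
Lemma vn_mulDl : left_distributive vn_mul +%R.
Proof. by move=> S T U; exact: vn_ext. Qed.
Lemma vn_mulDr : right_distributive vn_mul +%R.
Proof.
move=> S T U; apply: vn_ext => x.
change (S (T x + U x) = S (T x) + S (U x)).
by rewrite -[T x]scale1r vn_linear !scale1r.
Qed.

HB.instance Definition _ := GRing.Zmodule_isPzRing.Build vn_op
  vn_mulA vn_mul1 vn_mulr1 vn_mulDl vn_mulDr.

End OperatorRing.

(** * Adjoint, trace and 2-norm *)

Section OperatorTrace.
Context (R : realType) (H : completeNormedModType R[i]).
Variable dot : {dot H for (@Num.conj R[i])}.
Hypothesis hdot : hilbert_norm dot.
Variable M : set (H -> H).
Hypothesis hM : von_neumann_algebra dot M.
Variable tau : (H -> H) -> R[i].
Hypothesis htau : faithful_normal_tracial_state dot M tau.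
Notation A := (vn_op hM).
Implicit Types S T : A.

Definition vn_star T : A := to_vn hM (vn_adj hdot hM (vn_in T)).

Lemma vn_starP T : is_adjoint dot T (vn_star T).
Proof. have := vn_is_adjoint hdot hM. apply. exact: vn_in. Qed.

Lemma vn_star_unique S T : is_adjoint dot T S -> vn_star T = S.
Proof.
by move=> h; apply: val_inj; exact: (is_adjoint_unique hdot (vn_starP T) h).
Qed.

Lemma rdot_star T x y : re_dot dot (T x) y = re_dot dot x (vn_star T y).
Proof. by rewrite /re_dot vn_starP. Qed.

Lemma vn_star0 : vn_star 0 = 0.
Proof. by apply: vn_star_unique => x y; rewrite linear0l linear0r. Qed.

Lemma vn_star1 : vn_star 1 = 1.
Proof. exact: vn_star_unique. Qed.

Lemma vn_starD : {morph vn_star : S T / S + T}.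
Proof.
move=> S T; apply: vn_star_unique => x y.
change (dot (S x + T x) y = dot x (vn_star S y + vn_star T y)).
by rewrite linearDl linearDr /= !vn_starP.
Qed.

Lemma vn_starN T : vn_star (- T) = - vn_star T.
Proof. by apply: (@addrI _ (vn_star T)); rewrite -vn_starD !subrr vn_star0. Qed.

Lemma vn_starB S T : vn_star (S - T) = vn_star S - vn_star T.
Proof. by rewrite vn_starD vn_starN. Qed.

Lemma vn_starM S T : vn_star (S * T) = vn_star T * vn_star S.
Proof.
apply: vn_star_unique => x y.
change (dot (S (T x)) y = dot x (vn_star T (vn_star S y))).
by rewrite !vn_starP.
Qed.

Lemma vn_starK : involutive vn_star.
Proof. by move=> T; apply: vn_star_unique; exact: is_adjoint_sym (vn_starP T). Qed.

Lemma vn_starMn T n : vn_star (T *+ n) = vn_star T *+ n.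
Proof. by elim: n => [|n IH]; rewrite ?mulr0n ?vn_star0 // !mulrS vn_starD IH. Qed.

(** The real part is still additive, tracial and faithful, and on positive elements it is the whole
    trace. *)
Definition vn_tr T : R := complex.Re (tau T).

Lemma tau_linear (a : R[i]) (S T : H -> H) : M S -> M T ->
  tau (a *: S + T) = a * tau S + tau T.
Proof. by have [[+ _ _] _] := htau; apply. Qed.

Lemma vn_trD : {morph vn_tr : S T / S + T}.
Proof.
move=> S T; rewrite /vn_tr -raddfD -[in RHS](mul1r (tau S)) -tau_linear ?scale1r //; exact: vn_in.
Qed.

Lemma vn_tr0 : vn_tr 0 = 0.
Proof. by apply: (@addrI _ (vn_tr 0)); rewrite -vn_trD !addr0. Qed.

Lemma vn_trN T : vn_tr (- T) = - vn_tr T.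
Proof. by apply: (@addrI _ (vn_tr T)); rewrite -vn_trD !subrr vn_tr0. Qed.

Lemma vn_trB S T : vn_tr (S - T) = vn_tr S - vn_tr T.
Proof. by rewrite vn_trD vn_trN. Qed.

Lemma vn_trMn T n : vn_tr (T *+ n) = vn_tr T *+ n.
Proof. by elim: n => [|n IH]; rewrite ?mulr0n ?vn_tr0 // !mulrS vn_trD IH. Qed.

Lemma vn_tr_sum I (s : seq I) (F : I -> A) :
  vn_tr (\sum_(i <- s) F i) = \sum_(i <- s) vn_tr (F i).
Proof. exact: (big_morph _ vn_trD vn_tr0). Qed.

Lemma vn_tr1 : vn_tr 1 = 1.
Proof. by have [[_ _ h] _] := htau; rewrite /vn_tr h. Qed.

Lemma vn_trC S T : vn_tr (S * T) = vn_tr (T * S).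
Proof. by have [_ [_ _ h]] := htau; rewrite /vn_tr h //; exact: vn_in. Qed.

(** Positivity forces this: [tau] is real at [star S * S] for [S = i T + 1], and the imaginary part
    of its value there is the difference of the real parts of [tau T] and [tau (star T)]. *)
Lemma vn_tr_star T : vn_tr (vn_star T) = vn_tr T.
Proof.
have MT := vn_in T; have MT' := vn_in (vn_star T); have M1 := vn_id hM.
pose S : A := to_vn hM (vnD hM (vnZ hM 'i%C MT) M1).
have SE : vn_star S = to_vn hM (vnD hM (vnZ hM (- 'i%C) MT') M1).
  apply: vn_star_unique => x y.
  change (dot ('i%C *: T x + x) y = dot x (- 'i%C *: vn_star T y + y)).
  rewrite linearDl linearDr linearZl_LR linearZr_LR /= vn_starP.
  by congr (_ * _ + _); apply/eqP; rewrite eq_complex /= oppr0 opprK !eqxx.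
have [[_ + _] _] := htau => /(_ S (vn_in S)).
rewrite -[adj _ _]/(vn_val (vn_star S)) SE.
set U := (X in tau X); have -> : U =
    'i%C *: (T : H -> H) + (- 'i%C *: (vn_star T : H -> H) + (1 *: (vn_val (vn_star T * T)) + idfun)).
  apply/funext => x.
  change (- 'i%C *: vn_star T ('i%C *: T x + x) + ('i%C *: T x + x) =
    'i%C *: T x + (- 'i%C *: vn_star T x + (1 *: vn_star T (T x) + x))).
  rewrite vn_linear scalerDr scalerA mulNr -expr2 sqr_i opprK !scale1r.
  by rewrite [X in X + _]addrC addrACA [X in X + _]addrC -addrA.
have Ma := vn_in (vn_star T * T); have M2 := vnD hM (vnZ hM 1 Ma) M1.
have M3 := vnD hM (vnZ hM (- 'i%C) MT') M2.
rewrite (tau_linear _ MT M3) (tau_linear _ MT' M2) (tau_linear _ Ma M1).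
have [[_ h ->] _] := htau; have := h T MT; rewrite -[adj _ _ \o _]/(vn_val (vn_star T * T)).
rewrite /vn_tr !lecE /= => /andP[/eqP h0 _] /andP[/eqP + _].
move: h0; case: (tau _) => a b /= ->; case: (tau T) => c d; case: (tau (vn_star T)) => e f /=.
by move=> ?; lra.
Qed.

(** The squared 2-norm; keeping the square avoids roots. *)
Definition vn_nrm T : R := vn_tr (vn_star T * T).

Lemma vn_nrm_ge0 T : 0 <= vn_nrm T.
Proof.
have [[_ h _] _] := htau; have := h T (vn_in T).
by rewrite lecE => /andP[].
Qed.

Lemma vn_nrm_eq0 T : vn_nrm T = 0 -> T = 0.
Proof.
move=> h; have [[_ h1 _] [h2 _ _]] := htau; apply: val_inj.
apply: (h2 _ (vn_in T)); have := h1 _ (vn_in T).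
rewrite lecE => /andP[/eqP + _]; move: h; rewrite /vn_nrm /vn_tr.
rewrite -[adj _ _ \o _]/(vn_val (vn_star T * T)).
by case: (tau _) => a b /= -> ->.
Qed.

Lemma vn_nrm_star T : vn_nrm (vn_star T) = vn_nrm T.
Proof. by rewrite /vn_nrm vn_starK vn_trC. Qed.

Lemma vn_nrmD S T : vn_nrm (S + T) = vn_nrm S + 2 * vn_tr (vn_star S * T) + vn_nrm T.
Proof.
rewrite /vn_nrm vn_starD mulrDl !mulrDr !vn_trD.
rewrite -(vn_tr_star (vn_star T * S)) vn_starM vn_starK; ring.
Qed.

Lemma vn_nrmN T : vn_nrm (- T) = vn_nrm T.
Proof. by rewrite /vn_nrm vn_starN mulrNN. Qed.

Lemma vn_nrmB S T : vn_nrm (S - T) = vn_nrm S - 2 * vn_tr (vn_star S * T) + vn_nrm T.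
Proof. by rewrite vn_nrmD vn_nrmN mulrN vn_trN; ring. Qed.

Lemma vn_nrmMn T n : vn_nrm (T *+ n) = n%:R ^+ 2 * vn_nrm T.
Proof.
by rewrite /vn_nrm vn_starMn mulrnAl mulrnAr !vn_trMn -mulrnA -[LHS]mulr_natl natrM expr2.
Qed.

Lemma vn_nrmD_le S T : vn_nrm (S + T) <= 2 * (vn_nrm S + vn_nrm T).
Proof. by have := vn_nrm_ge0 (S - T); rewrite vn_nrmB vn_nrmD; lra. Qed.


End OperatorTrace.

Lemma cvgn_ext (T : topologicalType) (u v : nat -> T) (l : T) :
  u =1 v -> u n @[n --> \oo] --> l -> v n @[n --> \oo] --> l.
Proof. by move=> /funext ->. Qed.

(** * Limits of complex sequences *)

Section ComplexLimits.
Context (R : realType).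

Lemma cvg_Re (s : nat -> R[i]^o) (L : R[i]^o) :
  s n @[n --> \oo] --> L -> complex.Re (s n) @[n --> \oo] --> complex.Re L.
Proof.
move=> /cvgrPdist_le h; apply/cvgrPdist_le => /= e e0.
have /h : 0 < e%:C%C :> R[i] by rewrite ltcR.
move=> [N _ hN]; exists N => // n /= Nn; rewrite -lecR.
apply: le_trans (hN n Nn).
have -> : complex.Re L - complex.Re (s n) = complex.Re (L - s n).
  by rewrite raddfB.
exact: normc_ge_Re.
Qed.

Lemma cvg_complex (u v : nat -> R) (a b : R) :
  u n @[n --> \oo] --> a -> v n @[n --> \oo] --> b ->
  ((u n +i* v n)%C : R[i]^o) @[n --> \oo] --> ((a +i* b)%C : R[i]^o).
Proof.
move=> /cvgrPdist_le hu /cvgrPdist_le hv; apply/cvgrPdist_le => /= e e0.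
have e1 : 0 < complex.Re e / 2 by move: e0; rewrite ltcE => /andP[_ h]; rewrite divr_gt0.
have eE : e = (complex.Re e)%:C%C by rewrite RRe_real // realE (ltW e0).
have [N1 _ h1] := hu _ e1; have [N2 _ h2] := hv _ e1.
exists (maxn N1 N2) => // n /=; rewrite geq_max => /andP[n1 n2].
have -> : (a +i* b)%C - (u n +i* v n)%C = (a - u n)%:C%C + 'i%C * (b - v n)%:C%C :> R[i].
  by rewrite [LHS]complexE.
apply: le_trans (ler_normD _ _) _.
rewrite normrM (_ : `|'i%C| = 1) ?mul1r; last first.
  by rewrite normc_def /= expr0n expr1n add0r sqrtr1.
rewrite !normc_def /= expr0n !addr0 !sqrtr_sqr -rmorphD /= eE lecR [leRHS]splitr.
by apply: lerD; [exact: h1|exact: h2].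
Qed.

End ComplexLimits.

(** * Square-summable sequences and normality of the trace *)

Section SquareSummable.
Context (R : realType) (H : completeNormedModType R[i]).
Variable dot : {dot H for (@Num.conj R[i])}.
Hypothesis hdot : hilbert_norm dot.
Implicit Types (v w : nat -> H).
Notation rdot := (re_dot dot).
Notation nrm2 := (sqr_norm dot).

(** Bounded real partial sums replace convergence in [R[i]]; the terms being nonnegative, the two
    notions agree. *)
Definition sq_summable v := exists C, forall n, \sum_(0 <= l < n) nrm2 (v l) <= C.
Notation ssum := sq_summable.

Lemma series_nd (u : nat -> R) : (forall n, 0 <= u n) -> nondecreasing_seq (series u).
Proof.
move=> h; apply/nondecreasing_seqP => n.
by rewrite !seriesEnat /= big_nat_recr //= lerDl.
Qed.

Lemma nrm2_series_nd v : nondecreasing_seq (series (fun l => nrm2 (v l))).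
Proof. by apply: series_nd => n; exact: nrm2_ge0. Qed.

Lemma series_norm2E v n :
  series (fun n => `|v n| ^+ 2 : R[i]^o) n = (\sum_(0 <= l < n) nrm2 (v l))%:C%C.
Proof. by rewrite seriesEnat /= rmorph_sum; apply: eq_bigr => l _; exact: nrm2E. Qed.

Lemma square_summableP v : square_summable v <-> ssum v.
Proof.
split=> [/cvg_ex[L /cvg_Re]|[C hC]].
  move=> hL0; have hL : series (fun l => nrm2 (v l)) n @[n --> \oo] --> complex.Re L.
    by apply: cvgn_ext hL0 => n; exact: (congr1 (@complex.Re R) (series_norm2E v n)).
  exists (complex.Re L) => n.
  have cL : cvgn (series (fun l => nrm2 (v l))) by apply/cvg_ex; exists (complex.Re L).
  have := nondecreasing_cvgn_le (nrm2_series_nd v) cL n.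
  by rewrite (cvg_lim _ hL) // seriesEnat.
have cC : cvgn (series (fun l => nrm2 (v l))).
  apply: nondecreasing_is_cvgn (nrm2_series_nd v) _.
  by exists C => _ [n _ <-]; exact: hC.
have /cvg_ex[L hL] := cC.
apply/cvg_ex; exists (L +i* 0)%C.
by apply: cvgn_ext (cvg_complex hL (cvg_cst 0)) => n; exact: esym (series_norm2E v n).
Qed.

Lemma ssumD v w : ssum v -> ssum w -> ssum (fun l => v l + w l).
Proof.
move=> [C hC] [D hD]; exists (2 * (C + D)) => n.
apply: (@le_trans _ _ (\sum_(0 <= l < n) 2 * (nrm2 (v l) + nrm2 (w l)))).
  by apply: ler_sum => l _; exact: nrm2D_le hdot _ _.
by rewrite -mulr_sumr big_split ler_pM2l //= lerD.
Qed.

Lemma ssumZ (a : R) v : ssum v -> ssum (fun l => a%:C%C *: v l).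
Proof.
move=> [C hC]; exists (a ^+ 2 * C) => n.
under eq_bigr do rewrite nrm2Z.
by rewrite -mulr_sumr ler_wpM2l ?sqr_ge0.
Qed.

Lemma ssumN v : ssum v -> ssum (fun l => - v l).
Proof. by move=> [C hC]; exists C => n; under eq_bigr do rewrite nrm2N. Qed.

Lemma ssumB v w : ssum v -> ssum w -> ssum (fun l => v l - w l).
Proof. by move=> hv hw; exact: ssumD hv (ssumN hw). Qed.

Lemma ssum_op (T : H -> H) v : bounded_operator T -> ssum v -> ssum (fun l => T (v l)).
Proof.
move=> /(bounded_operator_nrm2 hdot)[C C0 hC] [D hD]; exists (C * D) => n.
apply: (@le_trans _ _ (C * \sum_(0 <= l < n) nrm2 (v l))); last by rewrite ler_wpM2l.
by rewrite mulr_sumr; apply: ler_sum.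
Qed.

Lemma rdot_series_cvg v w : ssum v -> ssum w ->
  cvgn (series (fun l => rdot (v l) (w l))).
Proof.
move=> [C hC] [D hD]; apply: normed_cvg.
apply: nondecreasing_is_cvgn.
  exact: (series_nd (fun l => normr_ge0 (rdot (v l) (w l)))).
exists (C + D) => _ [n _ <-] /=.
apply: (@le_trans _ _ (\sum_(0 <= l < n) (nrm2 (v l) + nrm2 (w l)))).
  by apply: ler_sum => l _; exact: rdot_le hdot _ _.
by rewrite big_split lerD.
Qed.

(** Meaningful for square-summable sequences, where the series converges; elsewhere [limn] may be a
    default value. *)
Definition l2_dot v w : R := limn (series (fun l => rdot (v l) (w l))).
Notation l2 := l2_dot.

Lemma l2_cvg v w : ssum v -> ssum w ->
  series (fun l => rdot (v l) (w l)) n @[n --> \oo] --> l2 v w.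
Proof. exact: rdot_series_cvg. Qed.

Lemma l2C v w : l2 v w = l2 w v.
Proof. by rewrite /l2_dot; congr (limn (series _)); apply/funext => l; rewrite rdotC. Qed.

Lemma l2Bl u v w : ssum u -> ssum v -> ssum w ->
  l2 (fun l => u l - v l) w = l2 u w - l2 v w.
Proof.
move=> hu hv hw; apply: cvg_lim => //.
apply: cvgn_ext (cvgB (l2_cvg hu hw) (l2_cvg hv hw)) => n.
rewrite !seriesEnat /= -sumrB; apply: eq_bigr => l _.
by rewrite rdotDl rdotNl.
Qed.

Lemma l2Zl (a : R) v w : ssum v -> ssum w ->
  l2 (fun l => a%:C%C *: v l) w = a * l2 v w.
Proof.
move=> hv hw; apply: cvg_lim => //.
apply: cvgn_ext (cvgM (cvg_cst a) (l2_cvg hv hw)) => n; rewrite /= !seriesEnat /= mulr_sumr.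
by apply: eq_bigr => l _; rewrite rdotZl.
Qed.

Lemma l2Zr (a : R) v w : ssum v -> ssum w ->
  l2 w (fun l => a%:C%C *: v l) = a * l2 w v.
Proof. by move=> hv hw; rewrite !(l2C w) l2Zl. Qed.

Lemma l2Br u v w : ssum u -> ssum v -> ssum w ->
  l2 w (fun l => u l - v l) = l2 w u - l2 w v.
Proof. by move=> hu hv hw; rewrite !(l2C w) l2Bl. Qed.

Lemma l2BB v w : ssum v -> ssum w ->
  l2 (fun l => v l - w l) (fun l => v l - w l) = l2 v v - 2 * l2 v w + l2 w w.
Proof.
move=> hv hw; have hvw := ssumB hv hw.
by rewrite l2Bl // !l2Br // (l2C w v); ring.
Qed.

Lemma l2_sum_le v n : ssum v -> \sum_(0 <= l < n) nrm2 (v l) <= l2 v v.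
Proof.
move=> hv; have := nondecreasing_cvgn_le (nrm2_series_nd v) (rdot_series_cvg hv hv) n.
by rewrite seriesEnat.
Qed.

Lemma l2_le v C : ssum v -> (forall n, \sum_(0 <= l < n) nrm2 (v l) <= C) -> l2 v v <= C.
Proof.
move=> hv h; apply: limr_le; first exact: rdot_series_cvg.
by exists 0%N => // n _; rewrite seriesEnat; exact: h.
Qed.

Lemma l2_ge0 v : ssum v -> 0 <= l2 v v.
Proof. by move=> hv; have := l2_sum_le 0 hv; rewrite big_geq. Qed.

Lemma l2_CS v w : ssum v -> ssum w -> l2 v w ^+ 2 <= l2 v v * l2 w w.
Proof.
move=> hv hw; apply: discriminant_le (l2_ge0 hw) _ => s.
have hs := ssumZ s hw.
by have := l2_ge0 (ssumB hv hs); rewrite l2BB // l2Zr // l2Zl // l2Zr //; lra.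
Qed.

(** Weak density speaks of complex normal functionals, while the orthogonality argument produces a
    real one. *)
Lemma normal_l2 (M : set (H -> H)) v w : (forall T, M T -> bounded_operator T) ->
  ssum v -> ssum w ->
  exists2 phi, normal dot M phi &
    forall T, M T -> complex.Re (phi T) = l2 (fun l => T (v l)) w.
Proof.
move=> bM hv hw.
have iw : ssum (fun l => 'i%C *: w l).
  by apply: ssum_op hw; apply: boundedZ; exact: bounded_id.
(* [dot] is conjugate-linear on the right, so pairing with [i w] in real part gives the imaginary
   part of pairing with [w]. *)
pose phi (T : H -> H) := (l2 (fun l => T (v l)) w +i* l2 (fun l => T (v l)) (fun l => 'i%C *: w l))%C.
exists phi => //; exists v, w; split; [exact/square_summableP|exact/square_summableP|].
move=> T MT; have hT := ssum_op (bM T MT) hv.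
apply: cvgn_ext (cvg_complex (l2_cvg hT hw) (l2_cvg hT iw)) => n; rewrite !seriesEnat /=.
elim: n => [|n IH]; first by rewrite !big_geq.
rewrite !big_nat_recr //= -IH; apply/eqP; rewrite eq_complex /=.
have -> : rdot (T (v n)) ('i%C *: w n) = complex.Im (dot (T (v n)) (w n)).
  by rewrite /re_dot linearZr_LR /=; case: (dot _ _) => a b /=; rewrite mul0r mulN1r opprK add0r.
rewrite /re_dot; set z := dot _ _.
by rewrite raddfD raddfD !eqxx.
Qed.

End SquareSummable.

(** * Estimates of the 2-norm *)

Section TraceNorm.
Context (R : realType) (H : completeNormedModType R[i]).
Variable dot : {dot H for (@Num.conj R[i])}.
Hypothesis hdot : hilbert_norm dot.
Variable M : set (H -> H).
Hypothesis hM : von_neumann_algebra dot M.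
Variable tau : (H -> H) -> R[i].
Hypothesis htau : faithful_normal_tracial_state dot M tau.
Notation A := (vn_op hM).
Implicit Types S T W : A.
Notation rdot := (re_dot dot).
Notation nrm2 := (sqr_norm dot).
Notation star := (vn_star hdot (hM := hM)).
Notation tr := (vn_tr (hM := hM) tau).
Notation nrm := (vn_nrm hdot (hM := hM) tau).
Notation ssum := (sq_summable dot).
Notation l2 := (l2_dot dot).

Lemma vn_add T x y : T (x + y) = T x + T y.
Proof. by rewrite -[x]scale1r vn_linear !scale1r. Qed.

Lemma vn_0 T : T 0 = 0.
Proof. by apply: (@addrI _ (T 0)); rewrite -vn_add !addr0. Qed.

Lemma vn_scale T a x : T (a *: x) = a *: T x.
Proof. by rewrite -[a *: x]addr0 vn_linear vn_0 addr0. Qed.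

Lemma vn_sub T x y : T (x - y) = T x - T y.
Proof. by rewrite vn_add -scaleN1r vn_scale scaleN1r. Qed.

Lemma vn_apply_sum T I (s : seq I) (F : I -> H) : T (\sum_(i <- s) F i) = \sum_(i <- s) T (F i).
Proof. exact: (big_morph _ (vn_add T) (vn_0 T)). Qed.

Lemma vn_ssum T v : ssum v -> ssum (fun l => T (v l)).
Proof. exact/ssum_op/vn_bdd. Qed.

(* Polarization turns the vectors [xi], [eta] of a normal trace into a single
   [zeta = (xi + eta) / 2], whose vector functional dominates the trace. *)
Lemma trace_dominated : exists2 zeta, ssum zeta &
  forall T, nrm T <= l2 (fun l => T (zeta l)) (fun l => T (zeta l)).
Proof.
have [_ [_ [xi [eta [sxi seta ht]]] _]] := htau.
move: sxi seta => /(square_summableP hdot) sxi /(square_summableP hdot) seta.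
pose c : R[i] := (2^-1)%:C%C.
pose zeta l := c *: (xi l + eta l).
have sz : ssum zeta by apply: ssumZ; exact: ssumD.
exists zeta => // T; have sT := vn_ssum T sz.
have h1 : series (fun l => rdot (T (xi l)) (T (eta l))) n @[n --> \oo] --> nrm T.
  apply: cvgn_ext (cvg_Re (ht _ (vn_in (star T * T)))) => n.
  rewrite !seriesEnat /=; elim: n => [|n IH]; first by rewrite !big_geq.
  rewrite !big_nat_recr //= -IH raddfD; congr (_ + _).
  by rewrite (rdotC _ (T _)) (rdot_star hdot) rdotC.
apply: (ler_cvg_to h1 (l2_cvg hdot sT sT)); exists 0%N => // n _ /=.
rewrite !seriesEnat; apply: ler_sum => l _.
rewrite /zeta /c vn_scale vn_add -[leRHS]/(nrm2 _) nrm2Z nrm2D.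
(* The difference of the two sides is a quarter of the squared norm of [T (xi l) - T (eta l)]. *)
by have := nrm2_ge0 hdot (T (xi l) - T (eta l)); rewrite nrm2B; lra.
Qed.

(** The constant is the squared length of the dominating vector. It need not be sharp: the convexity
    argument below asks only for boundedness. *)
Lemma vn_nrm_bounded : exists K, forall T (C : R), 0 <= C ->
  (forall x, nrm2 (T x) <= C * nrm2 x) -> nrm T <= C * K.
Proof.
have [zeta sz hz] := trace_dominated; exists (l2 zeta zeta) => T C C0 hC.
apply: le_trans (hz T) _; apply: l2_le => //; first exact: vn_ssum.
move=> n; apply: (@le_trans _ _ (C * \sum_(0 <= l < n) nrm2 (zeta l))).
  by rewrite mulr_sumr; exact: ler_sum.
by rewrite ler_wpM2l // l2_sum_le.
Qed.

(** Dominated convergence: the tail of the dominating vector is controlled by [C] uniformly in [k],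
    and the finitely many other coordinates converge by hypothesis. *)
Lemma vn_nrm_null (T : nat -> A) (C : R) : 0 <= C ->
  (forall k x, nrm2 (T k x) <= C * nrm2 x) ->
  (forall x, nrm2 (T k x) @[k --> \oo] --> (0 : R)) ->
  nrm (T k) @[k --> \oo] --> (0 : R).
Proof.
move=> C0 hC hT; have [zeta sz hz] := trace_dominated.
apply/cvgrPdist_le => /= e e0.
have C1 : 0 < C + 1 by rewrite ltr_wpDl.
have [n hn] : exists n, forall m, (n <= m)%N ->
    \sum_(n <= l < m) nrm2 (zeta l) <= e / 2 / (C + 1).
  have /cvgrPdist_lt : series (fun l => nrm2 (zeta l)) n @[n --> \oo] --> l2 zeta zeta by exact: l2_cvg.
  have e1 : 0 < e / 2 / (C + 1) by rewrite !divr_gt0.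
  move=> /(_ _ e1)[n _ h]; exists n => m nm.
  have := h n (leqnn n); have := l2_sum_le hdot m sz.
  rewrite /= (big_cat_nat _ nm) //= => h1 h2; apply: ltW; apply: le_lt_trans h2.
  by rewrite ler_normr; apply/orP; left; rewrite seriesEnat /=; lra.
have hfin : \sum_(0 <= l < n) nrm2 (T k (zeta l)) @[k --> \oo] --> (0 : R).
  by apply: null_sum => l; exact: hT.
move/cvgrPdist_le : hfin => /(_ (e / 2)); rewrite divr_gt0 // => /(_ isT)[k0 _ hk].
exists k0 => // k kk; have := hk k kk.
rewrite /= !sub0r !normrN !ger0_norm ?vn_nrm_ge0 //; last first.
  by apply: sumr_ge0 => l _; exact: nrm2_ge0.
move=> h; apply: le_trans (hz _) _; apply: l2_le => //; first exact: vn_ssum.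
move=> m; apply: (@le_trans _ _ (\sum_(0 <= l < maxn n m) nrm2 (T k (zeta l)))).
  rewrite (big_cat_nat _ (leq_maxr n m)) //= lerDl.
  by apply: sumr_ge0 => l _; exact: nrm2_ge0.
rewrite (big_cat_nat _ (leq_maxl n m)) //= [leRHS]splitr lerD //.
apply: (@le_trans _ _ (C * \sum_(n <= l < maxn n m) nrm2 (zeta l))).
  by rewrite mulr_sumr; apply: ler_sum => l _; exact: hC.
apply: (@le_trans _ _ (C * (e / 2 / (C + 1)))); first by rewrite ler_wpM2l // hn ?leq_maxl.
rewrite mulrA ler_pdivrMr // mulrC ler_pM2l ?divr_gt0 //; lra.
Qed.

(** The squared norm of [star W x] is the inner product of [W (star W x)] with [x]; Cauchy-Schwarz,
    then division. *)
Lemma vn_star_contraction W : (forall x, nrm2 (W x) <= nrm2 x) ->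
  forall x, nrm2 (star W x) <= nrm2 x.
Proof.
move=> hW x; have h : nrm2 (star W x) ^+ 2 <= nrm2 (star W x) * nrm2 x.
  rewrite {1}/sqr_norm -(rdot_star hdot).
  apply: le_trans (rdot_CS hdot _ _) _.
  by rewrite ler_wpM2r ?nrm2_ge0.
have [->|n0] := eqVneq (nrm2 (star W x)) 0; first exact: nrm2_ge0.
by move: h; rewrite expr2 ler_pM2l // lt_neqAle eq_sym n0 nrm2_ge0.
Qed.

(* [k |-> tr (T^* (W^* W)^k T)] is convex and bounded, hence nonincreasing. *)
Lemma vn_nrm_contraction W T : (forall x, nrm2 (W x) <= nrm2 x) -> nrm (W * T) <= nrm T.
Proof.
move=> hW; pose c := star W * W.
have c_star : star c = c by rewrite /c vn_starM vn_starK.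
pose a k := tr (star T * (c ^+ k * T)).
have a0 : a 0%N = nrm T by rewrite /a expr0 mul1r.
have a1 : a 1%N = nrm (W * T) by rewrite /a expr1 /vn_nrm vn_starM !mulrA.
have cX k : star (c ^+ k) = c ^+ k.
  elim: k => [|k IH]; first by rewrite expr0 vn_star1.
  by rewrite exprS vn_starM IH c_star -exprSr exprS.
have aE k l : a (k + l)%N = tr (star (c ^+ k * T) * (c ^+ l * T)).
  by rewrite /a vn_starM cX exprD !mulrA.
have aO k l : a (k + l).+1 = tr (star (W * (c ^+ k * T)) * (W * (c ^+ l * T))).
  by rewrite /a !vn_starM cX -addSn exprD exprSr /c !mulrA.
(* The second difference of [a] is a squared 2-norm: of [c^(j+1) T - c^j T] at [k = 2 j], and of its
   image under [W] at [k = 2 j + 1]. *)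
have convex k : 2 * a k.+1 <= a k + a k.+2.
  have := odd_double_half k; case: (odd k) => /=; rewrite -addnn.
    move=> <-; set j := k./2; rewrite add1n.
    have := vn_nrm_ge0 hdot htau (W * (c ^+ j.+1 * T) - W * (c ^+ j * T)).
    rewrite vn_nrmB // /vn_nrm -!aO !addnS !addSn; lra.
  rewrite add0n => <-; set j := k./2.
  have := vn_nrm_ge0 hdot htau (c ^+ j.+1 * T - c ^+ j * T).
  rewrite vn_nrmB // /vn_nrm -!aE !addnS !addSn; lra.
have [K hK] := vn_nrm_bounded.
have [D D0 hD] := bounded_operator_nrm2 hdot (vn_bdd T).
have hW' := vn_star_contraction hW.
have hc k x : nrm2 ((c ^+ k * T) x) <= D * nrm2 x.
  elim: k => [|k IH]; first by rewrite expr0 mul1r.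
  rewrite exprS -mulrA; apply: le_trans IH.
  exact: le_trans (hW' _) (hW _).
have bnd k : a k.*2 <= D * K.
  by rewrite -addnn aE; apply: hK (D0) _ => x; exact: hc.
(* A positive first increment would by convexity force linear growth, against the bound, which is
   known at even indices. *)
rewrite -a0 -a1 leNgt; apply/negP => gap.
have inc k : a 1%N - a 0%N <= a k.+1 - a k.
  by elim: k => // k IH; have := convex k; lra.
have lin k : k%:R * (a 1%N - a 0%N) <= a k - a 0%N.
  by elim: k => [|k IH]; rewrite ?mul0r ?subrr // -natr1 mulrDl mul1r; have := inc k; lra.
have := bnd; have := lin.
have [k hk] : exists k : nat, (D * K - a 0%N) / (a 1%N - a 0%N) < k.*2%:R.
  have g0 : 0 < a 1%N - a 0%N by rewrite subr_gt0.
  exists (Num.truncn `|(D * K - a 0%N) / (a 1%N - a 0%N)|).+1.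
  apply: le_lt_trans (ler_norm _) _; apply: lt_le_trans (truncnS_gt _) _.
  by rewrite ler_nat -addnn leq_addr.
move=> /(_ k.*2) h /(_ k); move: hk; rewrite ltr_pdivrMr ?subr_gt0 //; lra.
Qed.

Lemma vn_nrm_contractionr W T : (forall x, nrm2 (W x) <= nrm2 x) -> nrm (T * W) <= nrm T.
Proof.
move=> hW; rewrite -vn_nrm_star // vn_starM -[leRHS](vn_nrm_star hdot htau).
exact: vn_nrm_contraction (vn_star_contraction hW).
Qed.

End TraceNorm.

(** * From weak density to density in 2-norm *)

Section Density.
Context (R : realType) (H : completeNormedModType R[i]).
Variable dot : {dot H for (@Num.conj R[i])}.
Hypothesis hdot : hilbert_norm dot.
Variable M : set (H -> H).
Hypothesis hM : von_neumann_algebra dot M.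
Notation A := (vn_op hM).
Implicit Types T : A.
Notation nrm2 := (sqr_norm dot).
Notation ssum := (sq_summable dot).
Notation l2 := (l2_dot dot).

Let rate k : R := k.+1%:R^-1.

Let rate_gt0 k : 0 < rate k. Proof. by rewrite invr_gt0. Qed.

Let rate_cvg0 : rate k @[k --> \oo] --> (0 : R).
Proof. exact: cvg_harmonic. Qed.

Lemma sqr_null (x c : R) : (forall k, x ^+ 2 <= c * rate k) -> x = 0.
Proof.
move=> h; apply/eqP; rewrite -sqrf_eq0 eq_le sqr_ge0 andbT.
by apply: le_cvg0 h _; exact: nullM.
Qed.

(* A weakly dense real subspace [D] is dense for the norm of [T zeta]: otherwise
   the component of [T zeta] orthogonal to [D zeta] gives a normal functional
   vanishing on [D] but not at [T]. *)
Lemma weakly_dense_l2 (D E : set (H -> H)) (zeta : nat -> H) : D `<=` M ->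
  D 0 -> (forall (a : R) (S T : H -> H), D S -> D T -> D (a%:C%C *: S + T)) ->
  E `<=` D -> weakly_dense dot E M -> ssum zeta ->
  forall T (e : R), 0 < e -> exists2 S, D S &
    l2 (fun l => T (zeta l) - S (zeta l)) (fun l => T (zeta l) - S (zeta l)) <= e.
Proof.
move=> DM D0 Dlin ED [_ dense] sz T e e0.
have bD (S : H -> H) : D S -> bounded_operator S by move=> /DM; exact: vn_bounded hM _.
have sD (S : H -> H) : D S -> ssum (fun l => S (zeta l)) by move=> /bD bS; exact: ssum_op.
pose v (S : H -> H) l := T (zeta l) - S (zeta l).
have sT : ssum (fun l => T (zeta l)) by exact: vn_ssum.
have sv S : D S -> ssum (v S) by move=> /sD; exact: ssumB.
pose Q := [set l2 (v S) (v S) | S in D].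
have hQ : has_inf Q.
  by split; [exists (l2 (v 0) (v 0)), 0|exists 0 => _ [S DS <-]; exact/l2_ge0/sv].
have [d d_le dP] : exists2 d : R, (forall S, D S -> d <= l2 (v S) (v S)) &
    forall c, 0 < c -> exists S, D S /\ l2 (v S) (v S) <= d + c.
  exists (inf Q) => [S DS|c c0]; first by apply: ge_inf; [exact: hQ.2|exists S].
  have [_ [S DS <-] h] := inf_adherent c0 hQ.
  by exists S; split => //; exact: ltW.
(* A minimizing sequence for the squared distance [d] from [T zeta] to [D zeta]. *)
have /choice[x hx] : forall k, exists S, D S /\ l2 (v S) (v S) <= d + rate k.
  by move=> k; exact: dP.
have Dx k : D (x k) := (hx k).1.
(* Parallelogram law: the midpoint of [x k] and [x j] lies in [D], so its squared distance is at
   least [d]. It is written with [c = 1/2] and [b = -1] to fit the rules for differences and real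
   multiples. *)
have close k j : l2 (fun l => v (x k) l - v (x j) l) (fun l => v (x k) l - v (x j) l)
    <= 2 * (rate k + rate j).
  have [c cE] : exists c : R, c = 2^-1 by exists 2^-1.
  have [b bE] : exists b : R, b = -1 by exists (-1).
  pose m := c%:C%C *: x k + (c%:C%C *: x j + 0).
  have Dm : D m by apply: (Dlin) => //; exact: Dlin.
  have hm l : v m l = c%:C%C *: (v (x k) l - b%:C%C *: v (x j) l).
    rewrite /v /m -[(_ + _ : H -> H) (zeta l)]/(c%:C%C *: x k (zeta l) +
      (c%:C%C *: x j (zeta l) + 0)) addr0 bE rmorphN scaleN1r opprK.
    have half (y : H) : c%:C%C *: y + c%:C%C *: y = y.
      by rewrite -scalerDl -rmorphD /= (_ : c + c = 1) ?scale1r // cE; field.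
    by rewrite -{1}(half (T (zeta l))) opprD addrACA -!scalerBr -scalerDr.
  have := d_le _ Dm.
  rewrite (_ : v m = fun l => c%:C%C *: (v (x k) l - b%:C%C *: v (x j) l)); last exact/funext.
  have sk := sv _ (Dx k); have sj := sv _ (Dx j); have sj' := ssumZ b sj.
  have skj := ssumB hdot sk sj'; have skj' := ssumZ c skj.
  rewrite l2Zl // l2Zr // (l2BB hdot sk sj') l2Zr // l2Zl // l2Zr // (l2BB hdot sk sj).
  by rewrite cE bE; have := (hx k).2; have := (hx j).2; lra.
(* The sequence is Cauchy in each coordinate; its limit [kappa] is the component of [T zeta]
   orthogonal to [D zeta]. *)
have kappaP l : exists y, nrm2 (v (x k) l - y) @[k --> \oo] --> (0 : R).
  apply: (hilbert_complete hdot) => c c0.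
  have c1 : 0 < c / 4 by rewrite divr_gt0.
  have /cvgrPdist_le /(_ _ c1) [N _ hN] := rate_cvg0.
  exists N => k j Nk Nj.
  apply: le_trans (_ : _ <= 2 * (rate k + rate j)) _.
    apply: le_trans (close k j); apply: le_trans (l2_sum_le hdot l.+1 _).
      by rewrite big_nat_recr //= lerDr sumr_ge0 // => i _; exact: nrm2_ge0.
    by apply: ssumB => //; exact: sv.
  have := hN k Nk; have := hN j Nj; rewrite /= !sub0r !normrN !ger0_norm ?(ltW (rate_gt0 _)) //.
  by lra.
have /choice[kappa hkappa] := kappaP.
have kappa_sum k n : \sum_(0 <= l < n) nrm2 (v (x k) l - kappa l) <= 4 * rate k.
  rewrite -subr_le0.
  apply: (@le_cvg0 _ _ (fun j => 4 * rate j + 2 * \sum_(0 <= l < n) nrm2 (v (x j) l - kappa l))).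
    move=> j; rewrite lerBlDl addrA -mulrDr.
    apply: (@le_trans _ _ (\sum_(0 <= l < n) 2 * (nrm2 (v (x k) l - v (x j) l) +
        nrm2 (v (x j) l - kappa l)))).
      apply: ler_sum => l _; apply: le_trans (nrm2D_le hdot _ _).
      by rewrite addrA subrK.
    rewrite -mulr_sumr big_split /= mulrDr lerD2r.
    have h := close k j; apply: le_trans (_ : _ <= 2 * (2 * (rate k + rate j))) _; last by lra.
    rewrite ler_pM2l //; apply: le_trans h; apply: l2_sum_le => //.
    by apply: ssumB => //; exact: sv.
  by apply: nullD; apply: nullM => //; apply: null_sum => l; exact: hkappa.
have sk k : ssum (fun l => v (x k) l - kappa l) by exists (4 * rate k).
have skappa : ssum kappa.
  have := ssumB hdot (sv _ (Dx 0%N)) (sk 0%N).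
  by congr (sq_summable _ _); apply/funext => l; rewrite opprB addrC subrK.
have kappa_near k : l2 (fun l => v (x k) l - kappa l) (fun l => v (x k) l - kappa l) <= 4 * rate k.
  by apply: l2_le.
(* Moving [x k] along [S] cannot bring the squared distance below [d], so the discriminant bounds
   the inner product of [v (x k)] with [S zeta]. *)
have ortho S : D S -> l2 kappa (fun l => S (zeta l)) = 0.
  move=> DS; have sS := sD _ DS; set w := fun l => _ in sS *.
  have h1 k : l2 (v (x k)) w ^+ 2 <= rate k * l2 w w.
    apply: discriminant_le => [|s]; first exact: l2_ge0.
    have := d_le _ (Dlin s _ _ DS (Dx k)).
    rewrite (_ : v _ = fun l => v (x k) l - s%:C%C *: w l); last first.
      apply/funext => l; rewrite /v -[(_ + _ : H -> H) (zeta l)]/(s%:C%C *: w l + x k (zeta l)).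
      by rewrite opprD addrA addrAC.
    have ss := ssumZ s sS; have svk := sv _ (Dx k).
    rewrite l2BB // l2Zr // l2Zl // l2Zr //.
    by have := (hx k).2; lra.
  (* From [b^2 <= 2 a^2 + 2 (a - b)^2], with the two squares on the right at most [1] and [4] times
     [rate k * l2 w w]. *)
  apply: (@sqr_null _ (10 * l2 w w)) => k.
  have := l2_CS hdot (sk k) sS; rewrite (l2Bl hdot (sv _ (Dx k)) skappa sS) => h2.
  have h3 : (l2 (v (x k)) w - l2 kappa w) ^+ 2 <= 4 * rate k * l2 w w.
    by apply: le_trans h2 _; rewrite ler_wpM2r ?l2_ge0.
  have := h1 k; have := sqr_ge0 (2 * l2 (v (x k)) w - l2 kappa w); move: h3.
  set a := l2 (v _) w; set b := l2 kappa w; set c := rate k * l2 w w.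
  rewrite -!mulrA [l2 w w * _]mulrC -/c; nra.
have T_kappa : l2 (fun l => T (zeta l)) kappa = 0.
  apply: contrapT => /eqP kT0.
  have bM S : M S -> bounded_operator S by exact: vn_bounded hM _.
  (* The real part of [phi] vanishes on [D] by [ortho], so weak density forces it to vanish at [T]
     as well. *)
  have [phi nphi hphi] := normal_l2 hdot bM sz skappa.
  have e1 : 0 < (`|l2 (fun l => T (zeta l)) kappa|)%:C%C :> R[i] by rewrite ltcR normr_gt0.
  have [|S ES] := dense T (vn_in T) [:: phi] _ e1.
    by move=> psi; rewrite mem_seq1 => /eqP ->.
  move=> /(_ phi); rewrite mem_seq1 eqxx => /(_ isT) hS.
  have DS := ED _ ES; have := le_lt_trans (normc_ge_Re _) hS.
  rewrite raddfB /= (hphi _ (vn_in T)) (hphi _ (DM _ DS)).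
  by rewrite (l2C _ (fun l => S (zeta l))) (ortho _ DS) subr0 ltcR ltxx.
have vk k : l2 (v (x k)) kappa = 0.
  by rewrite (l2Bl hdot sT (sD _ (Dx k)) skappa) T_kappa (l2C _ _ kappa) ortho // subr0.
(* The [v (x k)] are orthogonal to [kappa] and converge to it. *)
have kk : l2 kappa kappa = 0.
  apply: (@sqr_null _ (4 * l2 kappa kappa)) => k.
  have := l2_CS hdot (sk k) skappa; rewrite (l2Bl hdot (sv _ (Dx k)) skappa skappa) vk sub0r sqrrN => h.
  by apply: le_trans h _; rewrite mulrAC ler_wpM2r ?l2_ge0.
have e4 : 0 < e / 4 by rewrite divr_gt0.
have /cvgrPdist_le /(_ _ e4) [N _ hN] := rate_cvg0.
exists (x N) => //.
have := hN N (leqnn N); have := kappa_near N.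
rewrite (l2BB hdot (sv _ (Dx N)) skappa) vk kk /= sub0r normrN ger0_norm ?(ltW (rate_gt0 _)) //.
by rewrite -/(v (x N)); lra.
Qed.

Variable tau : (H -> H) -> R[i].
Hypothesis htau : faithful_normal_tracial_state dot M tau.

(** The 2-norm is dominated by the norm at the vector [zeta] of [trace_dominated]. *)
Lemma weakly_dense_nrm (D E : set (H -> H)) : D `<=` M ->
  D 0 -> (forall (a : R) (S T : H -> H), D S -> D T -> D (a%:C%C *: S + T)) ->
  E `<=` D -> weakly_dense dot E M ->
  forall T (e : R), 0 < e -> exists2 S : A, D S & vn_nrm hdot tau (T - S) <= e.
Proof.
move=> DM D0 Dlin ED dense T e e0.
have [zeta sz hz] := trace_dominated hdot hM htau.
have [S DS hS] := weakly_dense_l2 DM D0 Dlin ED dense sz T e0.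
exists (to_vn hM (DM _ DS)) => //; apply: le_trans (hz _) _; exact: hS.
Qed.

End Density.

(** * Small projections in a diffuse algebra *)

Section Diffuse.
Context (R : realType) (H : completeNormedModType R[i]).
Variable dot : {dot H for (@Num.conj R[i])}.
Hypothesis hdot : hilbert_norm dot.
Variables (M P : set (H -> H)).
Hypotheses (hM : von_neumann_algebra dot M) (hP : von_neumann_algebra dot P).
Hypothesis PM : P `<=` M.
Variable tau : (H -> H) -> R[i].
Hypothesis htau : faithful_normal_tracial_state dot M tau.
Notation A := (vn_op hM).
Implicit Types (p q : A) (x y : H) (s : R).
Notation rdot := (re_dot dot).
Notation nrm2 := (sqr_norm dot).
Notation star := (vn_star hdot (hM := hM)).
Notation tr := (vn_tr (hM := hM) tau).
Notation nrm := (vn_nrm hdot (hM := hM) tau).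

(** Projections of [P], taken in the ring of [M], where the trace is available. *)
Definition vn_proj p := [/\ P p, star p = p & p * p = p].

Lemma vn_proj_nrm p : vn_proj p -> nrm p = tr p.
Proof. by case=> _ h1 h2; rewrite /vn_nrm h1 h2. Qed.

Lemma vn_proj_tr_ge0 p : vn_proj p -> 0 <= tr p.
Proof. by move=> /vn_proj_nrm <-; exact: vn_nrm_ge0. Qed.

Lemma vn_proj_tr_gt0 p : vn_proj p -> p <> 0 -> 0 < tr p.
Proof.
move=> pp p0; rewrite lt_neqAle vn_proj_tr_ge0 // andbT eq_sym.
by apply/eqP; rewrite -vn_proj_nrm // => /(vn_nrm_eq0 htau).
Qed.

Lemma vn_proj_nrm2 p x : vn_proj p -> nrm2 (p x) = rdot (p x) x.
Proof.
move=> [_ h1 h2]; rewrite /sqr_norm [LHS](rdot_star hdot) h1.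
by rewrite -[p (p x)]/((p * p) x) h2 rdotC.
Qed.

Lemma vn_proj_contraction p x : vn_proj p -> nrm2 (p x) <= nrm2 x.
Proof.
move=> /vn_proj_nrm2 h; have := nrm2_ge0 hdot (x - p x).
by rewrite nrm2B // (rdotC _ x) -h; lra.
Qed.

Lemma vn_proj1 : vn_proj 1.
Proof. by split; [exact: vn_id hP|exact: vn_star1|rewrite mulr1]. Qed.

(** Here and below [p * q = q] says that [q] is a subprojection of [p]; adjoints make it
    symmetric. *)
Lemma vn_proj_comm p q : vn_proj p -> vn_proj q -> p * q = q -> q * p = q.
Proof. by move=> [_ hp _] [_ hq _] h; have := congr1 star h; rewrite vn_starM hp hq. Qed.

Lemma vn_projB p q : vn_proj p -> vn_proj q -> p * q = q -> vn_proj (p - q).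
Proof.
move=> pp pq h; have h' := vn_proj_comm pp pq h; have [Pp hp hpp] := pp.
have [Pq hq hqq] := pq; split.
- exact: vnD hP _ _ Pp (vnN hP Pq).
- by rewrite vn_starB hp hq.
- by rewrite mulrBl !mulrBr hpp h h' hqq subrr subr0.
Qed.

Hypothesis diffP : diffuse dot P.

Lemma diffuse_proper p : vn_proj p -> p <> 0 ->
  exists q, [/\ vn_proj q, p * q = q, q <> 0 & q <> p].
Proof.
move=> pp p0; apply: contrapT => hn; apply: diffP; exists p.
have [Pp hp hpp] := pp; split=> //.
- split; last exact: (congr1 (@vn_val _ _ _ _ hM) hpp).
  by move=> x y; rewrite -{2}hp; exact: vn_starP.
- by move=> h; apply: p0; exact: val_inj.
move=> q Pq [qq qqq] qp; pose Q := to_vn hM (PM Pq).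
have pQ : vn_proj Q by split => //; [exact: vn_star_unique|exact: val_inj].
(* [p] kills [x - p x], so [q <= p] makes the form of [q] nonpositive there, and [q] kills it
   too. *)
have Qp : Q * p = Q.
  apply: vn_ext => x; have py : p (x - p x) = 0.
    by rewrite vn_sub -[p (p x)]/((p * p) x) hpp subrr.
  have : Q (x - p x) = 0.
    apply: (nrm2_eq0 hdot); apply/eqP; rewrite eq_le (nrm2_ge0 hdot) andbT.
    rewrite vn_proj_nrm2 //; have := qp (x - p x).
    rewrite -[(_ - _ : H -> H) _]/(p (x - p x) - Q (x - p x)) py sub0r.
    by rewrite lecE => /andP[_]; rewrite linearNl /= raddfN oppr_ge0.
  by rewrite vn_sub => /eqP; rewrite subr_eq0 => /eqP ->.
have pQQ : p * Q = Q by have [_ hQ _] := pQ; rewrite -{1}hQ -[p]hp -vn_starM Qp hQ.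
have [Q0|Q0] := pselect (Q = 0); first by left; exact: (congr1 (@vn_val _ _ _ _ hM) Q0).
have [QE|QE] := pselect (Q = p); first by right; exact: (congr1 (@vn_val _ _ _ _ hM) QE).
by exfalso; apply: hn; exists Q.
Qed.

(** A proper subprojection or its complement has at most half the trace. *)
Lemma diffuse_half p : vn_proj p -> p <> 0 ->
  exists q, [/\ vn_proj q, p * q = q, q <> 0 & tr q <= tr p / 2].
Proof.
move=> pp p0; have [q [pq pqq q0 qp]] := diffuse_proper pp p0.
have pB := vn_projB pp pq pqq.
have [h|h] := leP (tr q) (tr p / 2); first by exists q.
exists (p - q); split => //.
- by rewrite mulrBr pqq; have [_ _ ->] := pp.
- by move/eqP; rewrite subr_eq0 => /eqP /esym.
- by rewrite vn_trB //; lra.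
Qed.

Lemma diffuse_small p s : vn_proj p -> p <> 0 -> 0 < s ->
  exists q, [/\ vn_proj q, p * q = q, q <> 0 & tr q <= s].
Proof.
move=> pp p0 s0.
(* Repeated halving; the weak factor [n + 1] is enough and follows from [n + 2 <= 2 (n + 1)]. *)
have hn n : exists q, [/\ vn_proj q, p * q = q, q <> 0 & n.+1%:R * tr q <= tr p].
  elim: n => [|n [q [pq pqq q0 hq]]].
    by exists p; split => //; [have [] := pp|rewrite mul1r].
  have [r [pr qr r0 hr]] := diffuse_half pq q0.
  exists r; split => //; first by rewrite -qr mulrA pqq.
  apply: le_trans hq; apply: (@le_trans _ _ (n.+1%:R * (2 * tr r))).
    rewrite mulrA ler_wpM2r ?vn_proj_tr_ge0 // -natrM ler_nat muln2 -addnn.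
    by rewrite addSn ltnS leq_addl.
  by rewrite ler_wpM2l //; lra.
have [q [pq pqq q0 hq]] := hn (Num.truncn (tr p / s)).
exists q; split => //; rewrite leNgt; apply/negP => sq.
have : tr p < (Num.truncn (tr p / s)).+1%:R * s by rewrite -ltr_pdivrMr // truncnS_gt.
apply/negP; rewrite -leNgt; apply: le_trans hq.
by rewrite ler_wpM2l // ltW.
Qed.

(** The supremum of the admissible traces may not be attained, but more than half of it is, unless
    it is [0]. *)
Lemma greedy_small p s : vn_proj p -> 0 < s ->
  exists q, [/\ vn_proj q, p * q = q, tr q <= s &
    forall q', vn_proj q' -> p * q' = q' -> tr q' <= s -> tr q' <= 2 * tr q].
Proof.
move=> pp s0; pose E := [set tr q | q in [set q | [/\ vn_proj q, p * q = q & tr q <= s]]].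
have P0 : vn_proj 0.
  by split; [exact: vn0 hP|rewrite vn_star0|rewrite mulr0].
have E0 : E 0 by exists 0; [split => //; rewrite ?mulr0 ?vn_tr0 // ltW|rewrite vn_tr0].
have hE : has_sup E by split; [exists 0|exists s => _ [q [_ _ ?] <-]].
have ub q : vn_proj q -> p * q = q -> tr q <= s -> tr q <= sup E.
  by move=> *; apply: sup_upper_bound => //; exists q.
have [h|h] := leP (sup E) 0.
  exists 0; split; rewrite ?mulr0 ?vn_tr0 ?(ltW s0) // => q *.
  by rewrite mulr0; apply: le_trans h; exact: ub.
have h2 : 0 < sup E / 2 by rewrite divr_gt0.
have [_ [q [pq pqq qs] <-] hq] := sup_adherent h2 hE.
exists q; split => // q' pq' pqq' qs'; have := ub _ pq' pqq' qs'; lra.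
Qed.

(** The squared norm of [p_m x - p_n x] is the difference of two terms of a monotone bounded real
    sequence, whence a strong limit, which lies in [P]. Bounded strong convergence gives convergence
    in 2-norm, hence of the traces. *)
Lemma proj_decreasing_limit (pn : nat -> A) : (forall n, vn_proj (pn n)) ->
  (forall m n, (m <= n)%N -> pn m * pn n = pn n) ->
  exists L, [/\ vn_proj L, forall n, pn n * L = L &
    tr (pn n) - tr L @[n --> \oo] --> (0 : R)].
Proof.
move=> ppn mono.
have diff m n x : (m <= n)%N ->
    nrm2 (pn m x - pn n x) = rdot (pn m x) x - rdot (pn n x) x.
  move=> mn; have pB := vn_projB (ppn m) (ppn n) (mono _ _ mn).
  have := vn_proj_nrm2 x pB; rewrite -[(pn m - pn n) x]/(pn m x - pn n x) => ->.
  by rewrite rdotDl rdotNl.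
have Lex x : exists l, nrm2 (pn n x - l) @[n --> \oo] --> (0 : R).
  apply: (hilbert_complete hdot) => e e0.
  pose c n := rdot (pn n x) x.
  have c_ge0 n : 0 <= c n by rewrite /c -vn_proj_nrm2 // nrm2_ge0.
  have cni : {homo c : n m / (n <= m)%N >-> n >= m}.
    move=> m n mn; rewrite /c /= -subr_ge0 -diff //; exact: nrm2_ge0.
  have cc : cvgn c.
    by apply: nonincreasing_is_cvgn => //; exists 0 => _ [n _ <-].
  have [N _ hN] : \forall n \near \oo, `|limn c - c n| <= e / 2.
    by move/cvgrPdist_le : cc => /(_ (e / 2)); apply; rewrite divr_gt0.
  have close m n : (N <= m)%N -> (m <= n)%N -> nrm2 (pn m x - pn n x) <= e.
    move=> Nm mn; rewrite diff //; have := hN m Nm; have := hN n (leq_trans Nm mn).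
    by rewrite /= -/(c m) -/(c n) !ler_norml => /andP[? ?] /andP[? ?]; lra.
  exists N => m n Nm Nn; have [mn|/ltnW nm] := leqP m n; first exact: close.
  by rewrite -nrm2N opprB; exact: close.
have [L0 hL] := choice Lex.
have L0_bound x : nrm2 (L0 x) <= 2 * nrm2 x.
  rewrite -subr_le0; apply: (@le_cvg0 _ _ (fun n => 2 * nrm2 (pn n x - L0 x))).
    move=> n; rewrite lerBlDl -(nrm2N _ (pn n x - _)) opprB -mulrDr.
    apply: (@le_trans _ _ (2 * (nrm2 (pn n x) + nrm2 (L0 x - pn n x)))).
      apply: le_trans (nrm2D_le hdot _ _).
      by rewrite addrC subrK.
    by rewrite ler_pM2l // lerD2r vn_proj_contraction.
  exact: nullM.
have L0_linear : linear L0.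
  move=> a x y; apply/eqP; rewrite -subr_eq0; apply/eqP/(nrm2_eq0 hdot).
  apply/eqP; rewrite eq_le (nrm2_ge0 hdot) andbT.
  have [C C0 hC] := nrm2_scale_le hdot a.
  apply: (@le_cvg0 _ _ (fun n => 2 * (nrm2 (pn n (a *: x + y) - L0 (a *: x + y)) +
      2 * (C * nrm2 (pn n x - L0 x) + nrm2 (pn n y - L0 y))))).
    move=> n; apply: (@le_trans _ _ (2 * (nrm2 (L0 (a *: x + y) - pn n (a *: x + y)) +
        nrm2 (a *: (pn n x - L0 x) + (pn n y - L0 y))))).
      apply: le_trans (nrm2D_le hdot _ _).
      by rewrite vn_linear scalerBr [X in _ <= nrm2 (_ + X)]addrACA -opprD addrA subrK.
    rewrite -(nrm2N _ (L0 _ - _)) opprB ler_pM2l // lerD2l.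
    apply: le_trans (nrm2D_le hdot _ _) _.
    by rewrite ler_pM2l // lerD2r.
  apply: nullM; apply: nullD => //; apply: nullM; apply: nullD => //.
  exact: nullM.
have L0_bdd := nrm2_bounded_operator hdot L0_linear L0_bound.
have PL : P L0.
  by apply: (vn_strong_limit hdot hP (T := fun n => pn n)) => // n; have [] := ppn n.
pose L : A := to_vn hM (PM PL).
have nL : nrm (pn n - L) @[n --> \oo] --> (0 : R).
  (* [6 = 2 (1 + 2)], from the contraction [pn k] and the crude bound [2] for [L]. *)
  apply: (@vn_nrm_null _ _ _ hdot _ hM _ htau _ 6) => [//|k x|x]; last exact: hL.
  apply: (@le_trans _ _ (2 * (nrm2 (pn k x) + nrm2 (- L x)))); first exact: nrm2D_le hdot _ _.
  have := vn_proj_contraction x (ppn k); have := L0_bound x; rewrite nrm2N -[L x]/(L0 x); lra.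
have nrm_null T c : (forall n, nrm T <= c * nrm (pn n - L)) -> T = 0.
  move=> hT; apply: (vn_nrm_eq0 htau); apply/eqP; rewrite eq_le vn_nrm_ge0 // andbT.
  by apply: le_cvg0 hT _; exact: nullM.
have starL : star L = L.
  apply/eqP; rewrite -subr_eq0; apply/eqP; apply: (nrm_null _ 4) => n.
  have -> : star L - L = - (star (pn n - L)) + (pn n - L).
    by rewrite vn_starB; have [_ -> _] := ppn n; rewrite opprB addrA subrK.
  by apply: le_trans (vn_nrmD_le hdot htau _ _) _; rewrite vn_nrmN // vn_nrm_star //; lra.
have pL m : pn m * L = L.
  apply/eqP; rewrite -subr_eq0; apply/eqP; apply: (vn_nrm_eq0 htau).
  apply/eqP; rewrite eq_le vn_nrm_ge0 // andbT.
  apply: (@le_cvg0 _ _ (fun n => 4 * nrm (pn (n + m)%N - L))).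
    (* This uses [pn m * pn (n + m) = pn (n + m)]. *)
    move=> n; have -> : pn m * L - L = (pn (n + m)%N - L) - pn m * (pn (n + m)%N - L).
      by rewrite mulrBr mono ?leq_addl // opprB [RHS]addrC addrA subrK.
    apply: le_trans (vn_nrmD_le hdot htau _ _) _; rewrite vn_nrmN //.
    have : nrm (pn m * (pn (n + m)%N - L)) <= nrm (pn (n + m)%N - L).
      by apply: vn_nrm_contraction => // x; exact: vn_proj_contraction.
    by lra.
  apply: nullM; by rewrite (cvg_shiftn m (fun n => nrm (pn n - L))).
have Lp m : L * pn m = L.
  by have [_ hp _] := ppn m; rewrite -{1}starL -hp -vn_starM pL starL.
have LL : L * L = L.
  apply: vn_ext => x; apply/eqP; rewrite -subr_eq0; apply/eqP/(nrm2_eq0 hdot).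
  apply/eqP; rewrite eq_le (nrm2_ge0 hdot) andbT.
  apply: (@le_cvg0 _ _ (fun n => 2 * nrm2 (pn n x - L x))).
    move=> n; have E : L x = L (pn n x) by exact: (congr1 (fun T : A => T x) (esym (Lp n))).
    rewrite -[(L * L) x]/(L (L x)) [X in _ - X]E.
    by rewrite -vn_sub -(nrm2N _ (pn n x - _)) opprB; exact: L0_bound.
  by apply: nullM; exact: hL.
exists L; split => //.
refine (cvgn_ext _ nL) => n.
rewrite vn_nrmB // vn_proj_nrm //; have [_ -> _] := ppn n.
by rewrite pL /vn_nrm starL LL; lra.
Qed.

(** Greedy exhaustion. If the remainders kept trace above [1/2], their limit would be nonzero and
    contain a small projection [u]; each removed piece would have trace at least [tr u / 2], too
    much for total trace [1]. *)
Lemma diffuse_partition s : 0 < s ->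
  exists (r : nat) (f : 'I_r -> A), [/\ forall i, vn_proj (f i),
    forall i j, i != j -> f i * f j = 0, forall i, tr (f i) <= s &
    2^-1 <= \sum_i tr (f i)].
Proof.
move=> s0.
have /choice[next hnext] : forall p, exists q, vn_proj p -> [/\ vn_proj q, p * q = q, tr q <= s &
    forall q', vn_proj q' -> p * q' = q' -> tr q' <= s -> tr q' <= 2 * tr q].
  move=> p; have [pp|pp] := pselect (vn_proj p); last by exists 0.
  by have [q hq] := greedy_small pp s0; exists q.
(* [pn n] is what remains after removing [q 0, ..., q (n - 1)] from [1]. *)
pose pn n := iter n (fun p => p - next p) 1; pose q n := next (pn n).
have pnS n : pn n.+1 = pn n - q n by [].
have ppn n : vn_proj (pn n).
  by elim: n => [|n IH]; [exact: vn_proj1|rewrite pnS; have [? ? _ _] := hnext _ IH; exact: vn_projB].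
have qP n := hnext _ (ppn n).
have pq n : vn_proj (q n) by have [] := qP n.
have pnq n : pn n * q n = q n by have [] := qP n.
have mono m n : (m <= n)%N -> pn m * pn n = pn n.
  move=> /subnK <-; elim: (n - m)%N => [|k IH]; first by have [] := ppn m.
  by rewrite addSn pnS mulrBr IH -{1}(pnq (k + m)%N) mulrA IH pnq.
have ortho i n : (i < n)%N -> q i * pn n = 0.
  move=> lt; rewrite -(mono _ _ lt) mulrA pnS mulrBr.
  by rewrite (vn_proj_comm (ppn i) (pq i)) //; have [_ _ ->] := pq i; rewrite subrr mul0r.
have qq i j : (i < j)%N -> q i * q j = 0.
  by move=> lt; rewrite -(pnq j) mulrA ortho // mul0r.
have tr_pn n : tr (pn n) = 1 - \sum_(0 <= i < n) tr (q i).
  elim: n => [|n IH]; first by rewrite big_geq // subr0 vn_tr1.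
  by rewrite pnS vn_trB // IH big_nat_recr //= opprD addrA.
have [n hn] : exists n, tr (pn n) <= 2^-1.
  apply: contrapT => hno.
  have hlt n : 2^-1 < tr (pn n) by rewrite ltNge; apply/negP => ?; apply: hno; exists n.
  have [L [pL pnL tL]] := proj_decreasing_limit ppn mono.
  have trL : 2^-1 <= tr L.
    rewrite -subr_le0; apply: le_cvg0 _ tL => n.
    by rewrite lerD2r ltW.
  have L0 : L <> 0.
    by move=> h; move: trL; rewrite h vn_tr0 // leNgt invr_gt0 ltr0n.
  have [u [pu Lu u0 us]] := diffuse_small pL L0 s0.
  (* [u] lies below every [pn n], so it competed with each choice [q n]. *)
  have hu n : tr u <= 2 * tr (q n).
    by have [_ _ _] := qP n; apply => //; rewrite -Lu mulrA pnL.
  have u1 := vn_proj_tr_gt0 pu u0.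
  have sum_le n : n%:R * tr u <= 2.
    apply: (@le_trans _ _ (\sum_(0 <= i < n) 2 * tr (q i))).
      elim: n => [|n IH]; first by rewrite big_geq // mul0r.
      by rewrite big_nat_recr //= -natr1 mulrDl mul1r lerD.
    by rewrite -mulr_sumr; have := tr_pn n; have := vn_proj_tr_ge0 (ppn n); lra.
  have := sum_le (Num.truncn (2 / tr u)).+1; apply/negP; rewrite -ltNge.
  by rewrite -ltr_pdivrMr // truncnS_gt.
exists n, (fun i : 'I_n => q i); split => //.
- move=> i j ij; have [lt|lt|] := ltngtP i j; first exact: qq;
    last by move/val_inj/eqP; rewrite (negbTE ij).
  have [_ hi _] := pq i; have [_ hj _] := pq j.
  by rewrite -[_ * _]vn_starK vn_starM hi hj qq // vn_star0.
- by move=> i; have [] := qP i.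
have := tr_pn n; rewrite big_mkord; lra.
Qed.

End Diffuse.

(** * Finitely generated modules *)

Section MatrixAction.
Context (R : realType) (H : completeNormedModType R[i]).
Variable dot : {dot H for (@Num.conj R[i])}.
Hypothesis hdot : hilbert_norm dot.
Variable M : set (H -> H).
Hypothesis hM : von_neumann_algebra dot M.
Notation A := (vn_op hM).
Notation rdot := (re_dot dot).
Notation nrm2 := (sqr_norm dot).
Notation star := (vn_star hdot (hM := hM)).
Notation "X ^*m" := (star_mx star X) (at level 2).

(** Tuples stand for the Hilbert sum of copies of [H], with real inner product [vec_dot]. *)
Definition mv m n (X : 'M[A]_(m, n)) (v : 'I_n -> H) : 'I_m -> H :=
  fun i => \sum_j X i j (v j).

Definition vec_dot n (u v : 'I_n -> H) : R := \sum_i rdot (u i) (v i).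
Notation ip := vec_dot.

Lemma vn_sum_apply I (s : seq I) (F : I -> A) x :
  (\sum_(i <- s) F i) x = \sum_(i <- s) F i x.
Proof. exact: (big_morph (fun T : A => T x) (fun _ _ => erefl) erefl). Qed.

Lemma rdot_suml I (s : seq I) (F : I -> H) x :
  rdot (\sum_(i <- s) F i) x = \sum_(i <- s) rdot (F i) x.
Proof. exact: (big_morph (rdot^~ x) (fun y z => rdotDl dot y z x) (rdot0l dot x)). Qed.

Lemma rdot_sumr I (s : seq I) (F : I -> H) x :
  rdot x (\sum_(i <- s) F i) = \sum_(i <- s) rdot x (F i).
Proof. by rewrite rdotC rdot_suml; apply: eq_bigr => i _; rewrite rdotC. Qed.

Lemma mvM m n l (X : 'M[A]_(m, n)) (Y : 'M[A]_(n, l)) v :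
  mv (X *m Y) v = mv X (mv Y v).
Proof.
apply/funext => i; rewrite /mv.
under eq_bigr do rewrite mxE vn_sum_apply.
rewrite exchange_big; apply: eq_bigr => j _.
by rewrite vn_apply_sum.
Qed.

Lemma mv1 n (v : 'I_n -> H) : mv 1 v = v.
Proof.
apply/funext => i; rewrite /mv (bigD1 i) //= big1 ?addr0 => [|j ji]; rewrite mxE.
  by rewrite eqxx.
by rewrite eq_sym (negbTE ji).
Qed.

Lemma mvBl m n (X Y : 'M[A]_(m, n)) v i : mv (X - Y) v i = mv X v i - mv Y v i.
Proof. by rewrite /mv -sumrB; apply: eq_bigr => j _; rewrite !mxE. Qed.

Lemma mvB m n (X : 'M[A]_(m, n)) u v i :
  mv X (fun j => u j - v j) i = mv X u i - mv X v i.
Proof. by rewrite /mv -sumrB; apply: eq_bigr => j _; rewrite vn_sub. Qed.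

Lemma ip_star m n (X : 'M[A]_(m, n)) u v : ip (mv X u) v = ip u (mv X^*m v).
Proof.
rewrite /vec_dot /mv; under eq_bigr do rewrite rdot_suml.
rewrite exchange_big; apply: eq_bigr => j _; rewrite rdot_sumr.
by apply: eq_bigr => i _; rewrite mxE (rdot_star hdot).
Qed.

Lemma ipC n (u v : 'I_n -> H) : ip u v = ip v u.
Proof. by apply: eq_bigr => i _; rewrite rdotC. Qed.

Lemma ip_ge0 n (u : 'I_n -> H) : 0 <= ip u u.
Proof. by apply: sumr_ge0 => i _; exact: nrm2_ge0. Qed.

Lemma nrm2_le_ip n (u : 'I_n -> H) i : nrm2 (u i) <= ip u u.
Proof.
by rewrite /vec_dot (bigD1 i) //= lerDl; apply: sumr_ge0 => j _; exact: nrm2_ge0.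
Qed.

Lemma ipB n (u v : 'I_n -> H) :
  ip (fun j => u j - v j) (fun j => u j - v j) = ip u u - 2 * ip u v + ip v v.
Proof.
rewrite /vec_dot mulr_sumr -sumrB -big_split; apply: eq_bigr => i _.
exact: nrm2B.
Qed.

Lemma ipBl n (u v w : 'I_n -> H) : ip (fun j => u j - v j) w = ip u w - ip v w.
Proof. by rewrite /vec_dot -sumrB; apply: eq_bigr => i _; rewrite rdotDl rdotNl. Qed.

Lemma nrm2_sum I (s : seq I) (F : I -> H) :
  nrm2 (\sum_(i <- s) F i) <= 2 ^+ size s * \sum_(i <- s) nrm2 (F i).
Proof.
elim: s => [|i s IH]; first by rewrite !big_nil nrm20 mulr0.
rewrite !big_cons /=; apply: le_trans (nrm2D_le hdot _ _) _.
rewrite exprS -mulrA ler_pM2l // mulrDr lerD // ler_peMl ?nrm2_ge0 //.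
by rewrite exprn_ege1 // ler1n.
Qed.

Lemma mv_bounded m n (X : 'M[A]_(m, n)) : exists2 C, 0 <= C &
  forall v, ip (mv X v) (mv X v) <= C * ip v v.
Proof.
have /choice[C hC] : forall ij, exists C, 0 <= C /\ forall x, nrm2 (X ij.1 ij.2 x) <= C * nrm2 x.
  by move=> ij; have [C C0 hC] := bounded_operator_nrm2 hdot (vn_bdd (X ij.1 ij.2)); exists C.
exists (\sum_i 2 ^+ size (index_enum 'I_n) * \sum_j C (i, j)) => [|v].
  by apply: sumr_ge0 => i _; rewrite mulr_ge0 // sumr_ge0 // => j _; have [] := hC (i, j).
rewrite mulr_suml; apply: ler_sum => i _; apply: le_trans (nrm2_sum _ _) _.
rewrite -mulrA ler_wpM2l ?exprn_ge0 // mulr_suml; apply: ler_sum => j _.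
have [C0 h] := hC (i, j); apply: le_trans (h _) _.
by rewrite ler_wpM2l // nrm2_le_ip.
Qed.

Section Kernel.
Let sD := @vn_starD _ _ _ hdot _ hM.
Let sM := @vn_starM _ _ _ hdot _ hM.
Let sK := @vn_starK _ _ _ hdot _ hM.
Let s1 := @vn_star1 _ _ _ hdot _ hM.
Variables (m r : nat) (p : 'M[A]_(m, r)).
Hypothesis p_contr : forall v, ip (mv p v) (mv p v) <= ip v v.

(** Expand the squared norm of [p (star p v) - v] and use that [p] is contractive. *)
Let ps_contr v : ip (mv p^*m v) (mv p^*m v) <= ip v v.
Proof.
have := ip_ge0 (fun j => mv p (mv p^*m v) j - v j); rewrite ipB.
have := p_contr (mv p^*m v); rewrite [ip (mv p _) v]ip_star; lra.
Qed.

Let a : 'M[A]_r := p^*m *m p.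
Let T : 'M[A]_r := 1 - a.

Let a_star : a^*m = a.
Proof. by rewrite /a (star_mxM sD sM) (star_mxK sK). Qed.

Let T_star : T^*m = T.
Proof. by rewrite /T (star_mxB sD) (star_mx1 sD s1) a_star. Qed.

(** The moments of the self-adjoint [T] at [v]; their monotonicity replaces spectral calculus. *)
Let c v k := ip (mv (T ^+ k) v) v.

Let cE v i j : c v (i + j)%N = ip (mv (T ^+ i) v) (mv (T ^+ j) v).
Proof.
by rewrite /c exprD [RHS]ip_star (star_mxX sD sM s1 _ T_star) -mvM [RHS]ipC.
Qed.

Let ip_a u : ip (mv a u) u = ip (mv p u) (mv p u).
Proof. by rewrite ip_star a_star /a mvM -ip_star. Qed.

Let T_apply u : mv T u = fun i => u i - mv a u i.
Proof. by apply/funext => i; rewrite mvBl mv1. Qed.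

Let TS v k : mv (T ^+ k.+1) v = mv T (mv (T ^+ k) v).
Proof. by rewrite exprS -mvM. Qed.

Let c_even v k : c v (k + k)%N - c v (k + k.+1)%N =
  ip (mv p (mv (T ^+ k) v)) (mv p (mv (T ^+ k) v)).
Proof.
rewrite !cE TS T_apply -ip_a; set y := mv _ v.
by rewrite [X in _ - X]ipC ipBl opprB addrC subrK.
Qed.

(** With [y = T^k v], the difference is the squared norm of [p y] minus that of [star p (p y)]. *)
Let c_odd v k : 0 <= c v (k + k.+1)%N - c v (k.+1 + k.+1)%N.
Proof.
rewrite !cE TS T_apply; set y := mv _ v; rewrite ipB ipC ipBl.
have := ps_contr (mv p y); rewrite -mvM -/a -ip_a (ipC y); lra.
Qed.

Let c_ge0_le v k : 0 <= c v k <= ip v v /\ c v k.+1 <= c v k.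
Proof.
have c_even_ge0 j : 0 <= c v (j + j)%N by rewrite cE ip_ge0.
have step j : c v j.+1 <= c v j.
  rewrite -subr_ge0 -(odd_double_half j) -addnn; case: (odd j).
    by have := c_odd v j./2; rewrite add1n !addSn !addnS.
  by rewrite add0n -addnS c_even ip_ge0.
have c0 : c v 0%N = ip v v by rewrite /c expr0 mv1.
split => //; apply/andP; split; last first.
  by rewrite -c0; elim: k => // k IH; exact: le_trans (step k) IH.
rewrite -(odd_double_half k) -addnn; case: (odd k); last exact: c_even_ge0.
by rewrite add1n; apply: le_trans (step _); rewrite -addSn -addnS.
Qed.

Lemma power_contraction v k : ip (mv (T ^+ k) v) (mv (T ^+ k) v) <= ip v v.
Proof. by rewrite -cE; have [/andP[]] := c_ge0_le v (k + k). Qed.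

(** The squared norm is [c 0 - 2 c k + c (2 k)], and [c (2 k) <= c k] with [c k] nonnegative. *)
Lemma one_minus_power_contraction v k : ip (mv (1 - T ^+ k) v) (mv (1 - T ^+ k) v) <= ip v v.
Proof.
rewrite (_ : mv _ v = fun i => v i - mv (T ^+ k) v i); last first.
  by apply/funext => i; rewrite mvBl mv1.
rewrite ipB -cE (ipC v) -/(c v k).
have [/andP[h _] _] := c_ge0_le v k.
have : c v (k + k)%N <= c v k.
  elim: {1}k => // j; rewrite addSn; apply: le_trans; have [_] := c_ge0_le v (j + k).
  by [].
lra.
Qed.

Let c_lim v : cvgn (c v).
Proof.
apply: nonincreasing_is_cvgn; last by exists 0 => _ [n _ <-]; have [/andP[]] := c_ge0_le v n.
by apply/nonincreasing_seqP => n; have [] := c_ge0_le v n.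
Qed.

(* The powers of [1 - p^* p] converge strongly to the projection on [ker p]. *)
Lemma power_limit v : exists2 w : 'I_r -> H, mv p w = (fun=> 0) &
  forall i, nrm2 (mv (T ^+ k) v i - w i) @[k --> \oo] --> (0 : R).
Proof.
have close e : 0 < e -> exists N, forall k l, (N <= k)%N -> (N <= l)%N ->
    `|c v k - c v l| <= e.
  move=> e0; have e1 : 0 < e / 2 by rewrite divr_gt0.
  have /cvgrPdist_le /(_ _ e1)[N _ hN] := c_lim (v := v).
  exists N => k l Nk Nl; have := hN k Nk; have := hN l Nl.
  by rewrite /= !ler_norml => /andP[? ?] /andP[? ?]; apply/andP; split; lra.
have /choice[w hw] : forall i, exists l, nrm2 (mv (T ^+ k) v i - l) @[k --> \oo] --> (0 : R).
  move=> i; apply: (hilbert_complete hdot) => e e0.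
  have [|N hN] := close (e / 2); first by rewrite divr_gt0.
  exists N => k l Nk Nl.
  (* The squared distance between the two powers at [v] is [c (2 k) - 2 c (k + l) + c (2 l)]. *)
  have := nrm2_le_ip (fun i => mv (T ^+ k) v i - mv (T ^+ l) v i) i.
  rewrite ipB -!cE => h; apply: le_trans h _.
  have h1 := hN (k + k)%N (k + l)%N (leq_trans Nk (leq_addr _ _)) (leq_trans Nk (leq_addr _ _)).
  have h2 := hN (l + l)%N (k + l)%N (leq_trans Nl (leq_addr _ _)) (leq_trans Nk (leq_addr _ _)).
  by move: h1 h2; rewrite !ler_norml => /andP[? ?] /andP[? ?]; lra.
exists w => //; apply/funext => j; apply: (nrm2_eq0 hdot).
apply/eqP; rewrite eq_le (nrm2_ge0 hdot) andbT.
(* By [c_even], [c (2 k) - c (2 k + 1)] is the squared norm of [p (T^k v)], so [p] kills the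
   limit. *)
apply: (@le_cvg0 _ _ (fun k => 2 * (\sum_i nrm2 (mv (T ^+ k) v i - w i) +
    (c v (k + k)%N - c v (k + k.+1)%N)))).
  move=> k; apply: (@le_trans _ _ (2 * (nrm2 (mv p (fun i => mv (T ^+ k) v i - w i) j) +
      nrm2 (mv p (mv (T ^+ k) v) j)))).
    rewrite mvB -(nrm2N _ (_ - _)) opprB; apply: le_trans (nrm2D_le hdot _ _).
    by rewrite subrK.
  rewrite ler_pM2l // c_even lerD ?nrm2_le_ip //.
  by apply: le_trans (nrm2_le_ip _ _) _; exact: p_contr.
apply: nullM; apply: nullD; first exact: null_sum.
apply/cvgrPdist_le => /= e e0; have [N hN] := close e e0.
exists N => // k /= Nk; rewrite sub0r normrN.
by apply: hN; apply: leq_trans Nk _; exact: leq_addr.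
Qed.

End Kernel.
End MatrixAction.

(** * Right modules covered by finitely many generators *)

Section Modules.
Context (R : realType) (H : completeNormedModType R[i]).
Variable dot : {dot H for (@Num.conj R[i])}.
Hypothesis hdot : hilbert_norm dot.
Variables (M P : set (H -> H)).
Hypotheses (hM : von_neumann_algebra dot M) (hP : von_neumann_algebra dot P).
Hypothesis PM : P `<=` M.

(* Unlike membership in the quasi-normalizer, which asks [sp (P x P)] itself to be
   finitely generated, this weaker condition is visibly stable under sums. *)
Definition right_covered (x : H -> H) := exists (m : nat) (g : 'I_m -> H -> H),
  (forall j, linear (g j)) /\
  forall f, P f -> exists a : 'I_m -> H -> H,
    (forall j, P (a j)) /\ f \o x = \sum_j (g j \o a j).

Lemma linear_additive (g : H -> H) : linear g -> g 0 = 0 /\ {morph g : x y / x + y}.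
Proof.
move=> lg; have gD : {morph g : x y / x + y}.
  by move=> x y; rewrite -[x]scale1r lg !scale1r.
by split => //; apply: (@addrI _ (g 0)); rewrite -gD !addr0.
Qed.

Lemma right_covered0 : right_covered 0.
Proof.
exists 0%N, (fun _ => 0); split=> [[]//|f Pf]; exists (fun _ => 0); split=> [[]//|].
rewrite big_ord0; apply/funext => y /=.
by have [] := linear_additive (vn_bounded hP Pf).1.
Qed.

(** The generators are concatenated and [c] is absorbed into the coefficients, by linearity of the
    generators. *)
Lemma right_coveredD (c : R[i]) (x y : H -> H) :
  right_covered x -> right_covered y -> right_covered (c *: x + y).
Proof.
move=> [m [g [lg hg]]] [n [h [lh hh]]].
pose gh (j : 'I_(m + n)) := match fintype.split j with inl i => g i | inr i => h i end.
exists (m + n)%N, gh; split=> [j|f Pf]; first by rewrite /gh; case: fintype.split.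
have [a [Pa ha]] := hg f Pf; have [b [Pb hb]] := hh f Pf.
exists (fun j => match fintype.split j with inl i => c *: a i | inr i => b i end); split.
  by move=> j; case: fintype.split => // i; apply: (vnZ hP); exact: Pa.
have lf := (vn_bounded hP Pf).1; have [f0 fD] := linear_additive lf.
have linZ (k : H -> H) z : linear k -> k (c *: z) = c *: k z.
  by move=> lk; rewrite -[c *: z]addr0 lk (linear_additive lk).1 addr0.
apply/funext => z; rewrite fct_sumE big_split_ord /=.
have ha' := congr1 (@^~ z) ha; have hb' := congr1 (@^~ z) hb.
rewrite /= !fct_sumE in ha' hb'.
change (f (c *: x z + y z) = \sum_(i < m) gh (lshift n i)
  (match fintype.split (lshift n i) with inl i => c *: a i | inr i => b i end z) +
  \sum_(i < n) gh (rshift m i)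
  (match fintype.split (rshift m i) with inl i => c *: a i | inr i => b i end z)).
rewrite lf ha' hb' scaler_sumr; congr (_ + _); apply: eq_bigr => i _.
  rewrite /gh (_ : fintype.split (lshift n i) = inl i); last exact: (unsplitK (inl i)).
  by rewrite -(linZ (g i)).
by rewrite /gh (_ : fintype.split (rshift m i) = inr i); last exact: (unsplitK (inr i)).
Qed.

Lemma bimodule_span_sub T S : M T -> bimodule_span P T S -> M S.
Proof.
move=> MT [s [hs ->]]; elim: s hs => [|z s IH] hs.
  by rewrite big_nil; exact: vn0 hM.
rewrite big_cons; apply: (vnD hM).
  have [|a [b [Pa Pb ->]]] := hs z; first exact: mem_head.
  by apply: (vnZ hM); apply: (vn_comp hM); [apply: (vn_comp hM) => //; exact: PM|exact: PM].
by apply: IH => w ws; apply: hs; rewrite in_cons ws orbT.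
Qed.

(* The generators need not be linear maps a priori; they become so after
   subtracting their values at [0], whose sum vanishes. *)
Lemma quasi_normalizer_right_covered T : quasi_normalizer M P T -> right_covered T.
Proof.
move=> [MT _ [m [g hg]]].
have lin a : (forall i, P (a i)) -> linear (\sum_i (g i \o a i)).
  move=> Pa; apply: (vn_bounded hM (bimodule_span_sub MT _)).1.
  by rewrite hg; exists a.
have P0 := vn0 hP; have P1 := vn_id hP.
have g0 : \sum_i g i 0 = 0.
  by have [] := linear_additive (lin (fun=> 0) (fun=> P0)); rewrite fct_sumE.
exists m, (fun j y => g j y - g j 0); split=> [j|f Pf].
  (* These coefficients isolate [g j], up to the constant sum of the other [g i 0], which is
     [- g j 0]. *)
  have := lin (fun i => if i == j then idfun else 0); set F := \sum_i _ => lF.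
  suff -> : (fun y => g j y - g j 0) = F by apply: lF => i; case: ifP.
  have gj0 : \sum_(i | i != j) g i 0 = - g j 0.
    by move: g0; rewrite (bigD1 j) //= => /eqP; rewrite addrC addr_eq0 => /eqP.
  apply/funext => y; rewrite /F fct_sumE (bigD1 j) //= eqxx -gj0.
  by congr (_ + _); apply: eq_bigr => i /negbTE ->.
have : bimodule_span P T (f \o T).
  exists [:: (1, f \o T)]; split=> [z|]; last by rewrite big_seq1 scale1r.
  by rewrite mem_seq1 => /eqP ->; exists f, idfun; split.
rewrite hg => -[a [Pa ->]]; exists a; split=> //.
apply/funext => y; rewrite !fct_sumE /= sumrB g0 subr0.
by apply: eq_bigr.
Qed.

End Modules.

(** * Approximate right supports and their traces *)

Section ModuleSupport.
Context (R : realType) (H : completeNormedModType R[i]).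
Variable dot : {dot H for (@Num.conj R[i])}.
Hypothesis hdot : hilbert_norm dot.
Variables (M P : set (H -> H)).
Hypotheses (hM : von_neumann_algebra dot M) (hP : von_neumann_algebra dot P).
Hypothesis PM : P `<=` M.
Variable tau : (H -> H) -> R[i].
Hypothesis htau : faithful_normal_tracial_state dot M tau.
Notation A := (vn_op hM).
Notation nrm2 := (sqr_norm dot).
Notation star := (vn_star hdot (hM := hM)).
Notation tr := (vn_tr (hM := hM) tau).
Notation nrm := (vn_nrm hdot (hM := hM) tau).
Notation ip := (vec_dot dot).

Definition delta_vec r (i : 'I_r) (y : H) : 'I_r -> H := fun j => if j == i then y else 0.

Lemma mv_delta m r (X : 'M[A]_(m, r)) i y l : mv X (delta_vec i y) l = X l i y.
Proof.
rewrite /mv (bigD1 i) //= /delta_vec eqxx big1 ?addr0 // => j /negbTE ->.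
exact: vn_0.
Qed.

Lemma ip_delta r (i : 'I_r) y : ip (delta_vec i y) (delta_vec i y) = nrm2 y.
Proof.
rewrite /vec_dot (bigD1 i) //= /delta_vec eqxx big1 ?addr0 // => j /negbTE ->.
exact: rdot0l.
Qed.

(** The squared 2-norm of [1 - X] is at most [2 - 2 tr X]. *)
Lemma vn_tr_contraction_le1 (X : A) : (forall y, nrm2 (X y) <= nrm2 y) -> tr X <= 1.
Proof.
move=> hX; have := vn_nrm_ge0 hdot htau (1 - X).
have := vn_nrm_contraction hdot htau 1 hX.
rewrite mulr1 vn_nrmB // /vn_nrm vn_star1 !mul1r vn_tr1 //; lra.
Qed.

Lemma mx_mem_mul m n l (X : 'M[A]_(m, n)) (Y : 'M[A]_(n, l)) :
  (forall i j, P (X i j)) -> (forall i j, P (Y i j)) -> forall i j, P ((X *m Y) i j).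
Proof.
move=> PX PY i j; rewrite mxE; elim: (index_enum _) => [|k s IH].
  by rewrite big_nil; exact: vn0 hP.
by rewrite big_cons; apply: (vnD hP) => //; apply: (vn_comp hP); [exact: PX|exact: PY].
Qed.

Lemma mx_mem_sub1 n (X : 'M[A]_n) : (forall i j, P (X i j)) ->
  forall i j, P ((1 - X : 'M[A]_n) i j).
Proof.
move=> PX i j; rewrite !mxE; apply: (vnD hP); last by apply: (vnN hP); exact: PX.
by case: (_ == _); [exact: vn_id hP|exact: vn0 hP].
Qed.

Lemma mx_mem_exp n (X : 'M[A]_n) k : (forall i j, P (X i j)) ->
  forall i j, P ((X ^+ k) i j).
Proof.
move=> PX; elim: k => [|k IH] i j.
  by rewrite expr0 mxE; case: (_ == _); [exact: vn_id hP|exact: vn0 hP].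
by rewrite exprS; exact: mx_mem_mul.
Qed.

Lemma null_even (u : nat -> R) : u k @[k --> \oo] --> 0 -> u k.*2 @[k --> \oo] --> 0.
Proof.
move=> /cvgrPdist_le h; apply/cvgrPdist_le => /= e /h[N _ hN].
by exists N => // k /= Nk; apply: hN => /=; rewrite -addnn (leq_trans Nk) ?leq_addr.
Qed.

(* Murray-von Neumann dimension: the pieces [f_i x_k P] of a module with [m]
   generators are mutually orthogonal in [i], so the traces of their right
   supports add up to at most [m].  The contractions [z_i] approximate these
   supports. *)
Lemma module_support n (m0 : 'I_n -> nat) (x : 'I_n -> A) (g : forall k, 'I_(m0 k) -> H -> H) :
  (forall k j, linear (g k j)) ->
  (forall k f, P f -> exists a : 'I_(m0 k) -> H -> H,
    (forall j, P (a j)) /\ f \o x k = \sum_j (g k j \o a j)) ->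
  exists m : nat, forall r (f : 'I_r -> A), (forall i, P (f i)) ->
    (forall i, f i * f i = f i) -> (forall i j, i != j -> f i * f j = 0) ->
    forall e : R, 0 < e ->
    exists z : 'I_r -> A, [/\ forall i, P (z i),
      forall i, (forall y, nrm2 (z i y) <= nrm2 y) /\
                (forall y, nrm2 ((1 - z i) y) <= nrm2 y),
      forall i, 0 <= tr (z i), \sum_i tr (z i) <= m%:R &
      \sum_i \sum_k nrm (f i * x k * (1 - z i)) <= e].
Proof.
(* All generators of all [x k] together are indexed by [J], whose size depends neither on [r] nor on
   [f]. *)
move=> glin hg; pose J := {k : 'I_n & 'I_(m0 k)}; exists #|{: J}| => r f Pf ff f0 e e0.
pose a i k := sval (cid (hg k _ (Pf i))).
have ha i k : (forall j, P (a i k j)) /\ f i \o x k = \sum_j (g k j \o a i k j).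
  exact: svalP (cid (hg k _ (Pf i))).
pose a' i (l : J) := a i (tag l) (tagged l).
have Pa i l : P (a' i l) by have [h _] := ha i (tag l); exact: h.
(* Column [i] lists the coefficients of the [f i * x k], for all [k]; scaling by [s] then makes the
   matrix contractive. *)
pose p0 : 'M[A]_(#|{: J}|, r) := \matrix_(l, i) to_vn hM (PM (Pa i (enum_val l))).
have [C C0 hC] := mv_bounded hdot p0.
pose s := (C + 1)^-1.
have s0 : 0 < s by rewrite /s invr_gt0 ltr_wpDl.
have sC : s ^+ 2 * C <= 1.
  have C1 : 0 < C + 1 by rewrite ltr_wpDl.
  rewrite /s exprVn mulrC ler_pdivrMr ?exprn_gt0 //; nra.
pose p : 'M[A]_(#|{: J}|, r) := \matrix_(l, i) to_vn hM (vnZ hM s%:C%C (vn_in (p0 l i))).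
have Pp l i : P (p l i) by rewrite !mxE; apply: (vnZ hP); exact: Pa.
have mvp v l : mv p v l = s%:C%C *: mv p0 v l.
  by rewrite /mv scaler_sumr; apply: eq_bigr => i _; rewrite mxE.
have p_contr v : ip (mv p v) (mv p v) <= ip v v.
  rewrite /vec_dot (eq_bigr (fun l => s ^+ 2 * nrm2 (mv p0 v l))) => [|l _]; last first.
    by rewrite mvp; exact: nrm2Z.
  rewrite -mulr_sumr; apply: (@le_trans _ _ (s ^+ 2 * (C * ip v v))).
    by rewrite ler_pM2l ?exprn_gt0 //; exact: hC.
  by rewrite mulrA ler_piMl ?ip_ge0.
pose T : 'M[A]_r := 1 - star_mx star p *m p.
have PT i j : P (T i j).
  apply: mx_mem_sub1; apply: mx_mem_mul => // k l; rewrite mxE.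
  exact: (vn_adj hdot hP (Pp _ _)).
(* Even powers, as required by [mx_tr_le]. *)
pose z K i : A := (1 - T ^+ K.*2 : 'M[A]_r) i i.
have zE K i : 1 - z K i = (T ^+ K.*2) i i by rewrite /z !mxE eqxx opprB addrC subrK.
have zle K i y : nrm2 (z K i y) <= nrm2 y.
  rewrite -[in leRHS](ip_delta i) -mv_delta; apply: le_trans (nrm2_le_ip hdot _ _) _.
  exact: one_minus_power_contraction.
have Vle K i y : nrm2 ((T ^+ K) i i y) <= nrm2 y.
  rewrite -[in leRHS](ip_delta i) -mv_delta; apply: le_trans (nrm2_le_ip hdot _ _) _.
  exact: power_contraction.
have null i k : nrm (f i * x k * (T ^+ K.*2) i i) @[K --> \oo] --> (0 : R).
  have [D D0 hD] := bounded_operator_nrm2 hdot (vn_bdd (f i * x k)).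
  apply: (null_even (u := fun K => nrm (f i * x k * (T ^+ K) i i))).
  apply: (vn_nrm_null hdot htau D0) => [K y|y].
    by apply: le_trans (hD _) _; rewrite ler_wpM2l.
  (* Since [s] is nonzero, the limit [w] of [T^K] at [delta_vec i y] is also killed by [p0], hence
     the [f j (x k (w j))] sum to [0]. Applying [f i] leaves the term [j = i]. *)
  have [w pw hw] := power_limit hdot p_contr (delta_vec i y).
  have p0w l : \sum_j a' j l (w j) = 0.
    have := congr1 (@^~ (enum_rank l)) pw; rewrite mvp /mv => /eqP.
    rewrite scaler_eq0 => /orP[/eqP/(congr1 (@complex.Re R)) /= h|/eqP].
      by move: s0; rewrite h ltxx.
    by move=> h; rewrite -[RHS]h; apply: eq_bigr => j _; rewrite mxE enum_rankK.
  have fxw : \sum_j f j (x k (w j)) = 0.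
    rewrite (eq_bigr (fun j => \sum_l g k l (a' j (Tagged (fun k => 'I_(m0 k)) l) (w j)))); last first.
      move=> j _; have [_ /(congr1 (@^~ (w j)))] := ha j k.
      by rewrite fct_sumE.
    rewrite exchange_big big1 // => l _; have [gl0 glD] := linear_additive (glin k l).
    by rewrite -(big_morph _ glD gl0) p0w.
  have fxw_i : (f i * x k) (w i) = 0.
    have := congr1 (f i) fxw; rewrite vn_0 vn_apply_sum (bigD1 i) //= big1 ?addr0.
      by rewrite -[f i (f i _)]/((f i * f i) _) ff.
    by move=> j ji; rewrite -[f i (f j _)]/((f i * f j) _) f0 // eq_sym.
  apply: (@squeeze0 _ _ (fun K => D * nrm2 (mv (T ^+ K) (delta_vec i y) i - w i))).
    move=> K; rewrite nrm2_ge0 //= mv_delta.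
    apply: le_trans (hD _); rewrite vn_sub fxw_i subr0; exact: lexx.
  by apply: nullM; exact: hw.
have := null_sum (index_enum 'I_r) (fun i => null_sum (index_enum 'I_n) (null i)).
move=> /cvgrPdist_le /(_ e e0)[K _ /(_ K (leqnn K))]; rewrite /= sub0r normrN => hK.
exists (z K); split.
- by move=> i; apply: mx_mem_sub1; exact: mx_mem_exp.
- by move=> i; split=> y; [exact: zle|have := Vle K.*2 i y; rewrite -zE].
- move=> i; have := vn_tr_contraction_le1 (Vle K.*2 i).
  by rewrite -zE vn_trB // vn_tr1 // gerBl.
- apply: (mx_tr_le (vn_starD hdot (hM := hM)) (vn_starM hdot (hM := hM))
    (vn_starK hdot (hM := hM)) (vn_star1 hdot hM)).
  + exact: vn_trD.
  + exact: vn_trC.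
  + exact: vn_nrm_ge0.
  + exact: vn_tr1.
apply: le_trans hK; apply: le_trans (ler_norm _).
by apply: ler_sum => i _; apply: ler_sum => k _; rewrite zE.
Qed.

End ModuleSupport.

(** * Averages over unitaries *)

Section Averages.
Context (R : realType) (H : completeNormedModType R[i]).
Variable dot : {dot H for (@Num.conj R[i])}.
Hypothesis hdot : hilbert_norm dot.
Variables (M P : set (H -> H)).
Hypothesis hM : von_neumann_algebra dot M.
Hypothesis PM : P `<=` M.
Variable tau : (H -> H) -> R[i].
Hypothesis htau : faithful_normal_tracial_state dot M tau.
Notation A := (vn_op hM).
Notation nrm2 := (sqr_norm dot).
Notation star := (vn_star hdot (hM := hM)).
Notation tr := (vn_tr (hM := hM) tau).
Notation nrm := (vn_nrm hdot (hM := hM) tau).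

(** Expand the squared 2-norm of [f - 8 W f], where [8 W] is a contraction. *)
Lemma vn_tr_small (W f : A) : star f = f -> f * f = f ->
  (forall y, nrm2 (W y) <= 8^-1 ^+ 2 * nrm2 y) -> tr (f * W) <= 8^-1 * tr f.
Proof.
move=> sf ff hW.
have h : nrm ((W *+ 8) * f) <= nrm f.
  apply: vn_nrm_contraction => // y.
  have -> : (W *+ 8) y = 8%:C%C *: W y.
    rewrite (_ : 8%:C%C = 8%:R :> R[i]) ?rmorph_nat // scaler_nat.
    by elim: 8%N => // n IH; rewrite !mulrS -IH.
  by rewrite nrm2Z; have := hW y; lra.
have E : tr (star f * ((W *+ 8) * f)) = 8 * tr (f * W).
  rewrite sf [X in tr (_ * X)]mulrnAl [X in tr X]mulrnAr vn_trMn // -[LHS]mulr_natl; congr (_ * _).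
  by rewrite vn_trC // -mulrA ff vn_trC.
have := vn_nrm_ge0 hdot htau (f - (W *+ 8) * f).
rewrite vn_nrmB // E; have -> : nrm f = tr f by rewrite /vn_nrm sf ff.
move: h; have -> : nrm f = tr f by rewrite /vn_nrm sf ff.
by move: (nrm _) (tr f) (tr (f * W)) => *; lra.
Qed.

(** Bessel: the sum [F] of the [f i] is a projection, and the gap is the squared 2-norm of
    [y - F y]. *)
Lemma vn_nrm_sum_proj r (f : 'I_r -> A) (y : A) : (forall i, star (f i) = f i) ->
  (forall i, f i * f i = f i) -> (forall i j, i != j -> f i * f j = 0) ->
  \sum_i nrm (f i * y) <= nrm y.
Proof.
move=> sf ff f0; pose F := \sum_i f i.
have sF : star F = F.
  rewrite /F (big_morph _ (vn_starD hdot (hM := hM)) (vn_star0 hdot hM)).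
  exact: eq_bigr.
have FF : F * F = F.
  rewrite {1}/F mulr_suml; apply: eq_bigr => i _.
  rewrite /F mulr_sumr (bigD1 i) //= ff big1 ?addr0 // => j ji.
  by rewrite f0 // eq_sym.
have -> : \sum_i nrm (f i * y) = tr (star y * (F * y)).
  rewrite /F mulr_suml mulr_sumr vn_tr_sum //; apply: eq_bigr => i _.
  by rewrite /vn_nrm vn_starM sf -mulrA (mulrA (f i)) ff.
have := vn_nrm_ge0 hdot htau (y - F * y).
rewrite vn_nrmB // /vn_nrm vn_starM sF -(mulrA (star y)) (mulrA F) FF; lra.
Qed.

Lemma tau_scale (c : R[i]) (T : H -> H) : M T -> tau (c *: T) = c * tau T.
Proof.
move=> MT; have h0 : M 0 by exact: vn0 hM.
have t0 : tau 0 = 0.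
  have := tau_linear htau (-1) h0 h0.
  by rewrite scaler0 addr0 mulN1r => /eqP; rewrite addrC subrr => /eqP.
by rewrite -[c *: T]addr0 (tau_linear htau _ MT h0) t0 addr0.
Qed.

Lemma vn_tr_scale (a : R) (T : A) (h : M (a%:C%C *: (T : H -> H))) :
  tr (to_vn hM h) = a * tr T.
Proof. by rewrite /vn_tr -Re_realM -tau_scale //; exact: vn_in. Qed.

(** The trace of a projection is real, so the real part of [c] factors out. *)
Lemma vn_tr_scale_real (c : R[i]) (f : A) (h : M (c *: (f : H -> H))) :
  star f = f -> f * f = f -> tr (to_vn hM h) = complex.Re c * tr f.
Proof.
move=> sf ff; have [[_ tpos _] _] := htau; have := tpos _ (vn_in f).
rewrite -[adj _ _ \o _]/(vn_val (star f * f)) sf ff lecE => /andP[/eqP fi _].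
rewrite /vn_tr [tau _]tau_scale; last exact: vn_in.
by move: fi; case: (tau f) => a b /= ->; case: c {h} => a' b' /=; rewrite mulr0 subr0.
Qed.

(** The average of the conjugates of [z] is within [1/8] of a scalar. Testing against [1] puts the
    real part of the scalar below [tr z + 1/8]; testing against [f] costs another [1/8]. *)
Lemma compressible_bound : compressible dot M P ->
  exists n (u : 'I_n -> A), [/\ (0 < n)%N,
    forall k, u k * star (u k) = 1 /\ star (u k) * u k = 1 &
    forall z : A, P z -> (forall y, nrm2 (z y) <= nrm2 y) ->
      forall f : A, star f = f -> f * f = f ->
      \sum_k tr (f * (u k * z * star (u k))) <= n%:R * ((tr z + 4^-1) * tr f)].
Proof.
move=> /(_ (8^-1 : R)%:C%C) []; first by rewrite ltcR invr_gt0.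
move=> U0 [_ n0 hU hc]; set n := size U0 in n0.
have uU (k : 'I_n) : unitary_group dot M (nth 0 U0 k) by apply: hU; exact: mem_nth.
have uM (k : 'I_n) : M (nth 0 U0 k) by have [] := uU k.
pose u (k : 'I_n) := to_vn hM (uM k).
have uu k : u k * star (u k) = 1 /\ star (u k) * u k = 1.
  by have [_ h1 h2] := uU k; split; exact: val_inj.
exists n, u; split => // z Pz hz f sf ff.
have [//||X0 [[c hX0] _] hX] := hc 1%N (\matrix_(i, j) (z : H -> H)).
  split=> [i j|xi]; first by rewrite mxE.
  by rewrite /l2_norm !big_ord1 mul1r /mx_apply !big_ord1 mxE !sqrCK //
    ?(nrm2_sqrt hdot) lecR ler_sqrt ?nrm2_ge0.
pose Y : A := \sum_k u k * z * star (u k).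
pose n1 : R := n%:R^-1.
have MW : M (n1%:C%C *: (Y : H -> H) + - c 0 0 *: (idfun : H -> H)).
  by apply: (vnD hM); apply: (vnZ hM); [exact: vn_in|exact: vn_id hM].
pose W := to_vn hM MW.
have hW y : nrm2 (W y) <= 8^-1 ^+ 2 * nrm2 y.
  have := hX (fun=> y); rewrite /l2_norm !big_ord1 /mx_apply !big_ord1 !sqrCK //.
  have -> : (conj_average dot U0 (\matrix_(i, j) (z : H -> H)) - X0) 0 0 y = W y.
    rewrite !mxE hX0.
    change (((size U0)%:R^-1 : R[i]) *:
      (\sum_(u <- U0) (u \o (z : H -> H) \o adj dot u)) y +
      - (c 0 0 *: y) = n1%:C%C *: Y y + - c 0 0 *: y).
    rewrite scaleNr; congr (_ *: _ - _); first by rewrite /n1 fmorphV rmorph_nat.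
    rewrite (big_nth 0) big_mkord /Y vn_sum_apply fct_sumE.
    exact: eq_bigr.
  rewrite (nrm2_sqrt hdot y) -rmorphM /= (nrm2_le_norm hdot) ?mulr_ge0 ?sqrtr_ge0 ?invr_ge0 //.
  by rewrite exprMn sqr_sqrtr ?nrm2_ge0.
have fW (g : A) : star g = g -> g * g = g ->
    tr (g * W) = n1 * tr (g * Y) - complex.Re (c 0 0) * tr g.
  move=> sg gg.
  have -> : g * W = to_vn hM (vnZ hM n1%:C%C (vn_in (g * Y))) +
      to_vn hM (vnZ hM (- c 0 0) (vn_in g)).
    apply: vn_ext => y.
    change (g (n1%:C%C *: Y y + - c 0 0 *: y) = n1%:C%C *: g (Y y) + - c 0 0 *: g y).
    by rewrite vn_linear vn_scale.
  by rewrite vn_trD // vn_tr_scale vn_tr_scale_real // raddfN mulNr.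
have trY : tr Y = n%:R * tr z.
  rewrite /Y vn_tr_sum // (eq_bigr (fun=> tr z)) => [|k _].
    by rewrite sumr_const card_ord mulr_natl.
  by rewrite -mulrA vn_trC // -mulrA (uu k).2 mulr1.
have nn : (0 : R) < n%:R by rewrite ltr0n.
have tf : 0 <= tr f by have := vn_nrm_ge0 hdot htau f; rewrite /vn_nrm sf ff.
have h1 := vn_tr_small sf ff hW.
(* The sign of [W] is reversed to bound the scalar from above. *)
have h2 : tr (1 * - W) <= 8^-1 * tr 1.
  apply: vn_tr_small; [exact: vn_star1|exact: mulr1|] => y.
  by rewrite -[(- W) y]/(- (W y)) nrm2N.
move: h2; rewrite mulrN vn_trN // fW ?mulr1 //; last exact: vn_star1.
rewrite mul1r vn_tr1 // trY mulr1 mulrA /n1 mulVf ?gt_eqF // mul1r => h2.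
move: h1; rewrite fW // => h1.
have -> : \sum_k tr (f * (u k * z * star (u k))) = tr (f * Y).
  by rewrite /Y mulr_sumr vn_tr_sum.
rewrite -ler_pdivrMl //; apply: (@le_trans _ _ ((complex.Re (c 0 0) + 8^-1) * tr f)).
  by rewrite -/n1; lra.
by rewrite ler_wpM2r //; lra.
Qed.

End Averages.

(** * Choice of a small projection and contradiction *)

Theorem corollary2p8 (R : realType) (H : completeNormedModType R[i])
    (dot : {dot H for (@Num.conj R[i])}) (hdot : hilbert_norm dot)
    (M P : set (H -> H)) (tau : (H -> H) -> R[i]) :
  von_neumann_algebra dot M ->
  faithful_normal_tracial_state dot M tau ->
  von_neumann_algebra dot P ->
  P `<=` M ->
  diffuse dot P ->
  quasi_regular dot M P ->
  ~ compressible dot M P.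
Proof.
(* The error budget [1/64] is shared equally by the unitaries and the supports. Weighted by [16] it
   is [1/4], and with the [1/8] for the traces of the [z i] it stays below [1/2]. *)
have arith_sum : 128^-1 + 128^-1 <= 64^-1 :> R by lra.
have arith_pick (a b c : R) : a <= 64^-1 -> b <= 8^-1 -> c <= 16 * a + b -> c < 2^-1 by lra.
have arith_pos (a b c : R) : 0 <= a -> 0 <= b -> 16 * a + b < c -> 0 < c by lra.
have arith_small (a b c d : R) : 0 <= a -> 16 * a + b < c -> c <= d / 8 -> b < d * 8^-1 by lra.
have arith_err (a b c d e f : R) : a <= 2 * (b + c) -> b <= d -> d + c <= e ->
  0 <= f -> 0 <= e -> forall h, 16 * e + f < h -> a <= 8^-1 * h.
  by move=> *; lra.
have arith_key (a b c : R) : 0 <= a - 2 * (b *+ 2) + 2 ^+ 2 * c -> c <= 8^-1 * a ->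
  5 / 8 * a <= a - b by lra.
have arith_end (a b : R) : 0 < a -> b * a <= 8^-1 * a -> 5 / 8 * a <= (b + 4^-1) * a -> False by lra.
move=> hM htau hP PM diffP qr cP.
pose nrm := vn_nrm hdot (hM := hM) tau; pose tr := vn_tr (hM := hM) tau.
have [n [u [n0 uu bound]]] := compressible_bound hdot hM htau cP.
have nn : (0 : R) < n%:R by rewrite ltr0n.
(* A subspace containing the quasi-normalizer, as the density lemma requires. *)
pose D := [set T | M T /\ right_covered P T].
have DM : D `<=` M by move=> T [].
have D0 : D 0 by split; [exact: vn0 hM|exact: right_covered0 hP].
have Dlin (a : R) (S T : H -> H) : D S -> D T -> D (a%:C%C *: S + T).
  move=> [MS cS] [MT cT]; split; last exact: (right_coveredD hP).
  by apply: (vnD hM) => //; exact: (vnZ hM).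
have qD : quasi_normalizer M P `<=` D.
  by move=> T qT; split; [case: qT|exact: (quasi_normalizer_right_covered hM hP PM)].
have [d d0 dn] : exists2 d : R, 0 < d & n%:R * d <= 128^-1.
  exists (128 * n%:R)^-1; first by rewrite invr_gt0 mulr_gt0.
  by rewrite invfM mulrCA mulfV ?gt_eqF // mulr1.
have /choice[x hx] : forall k, exists S : vn_op hM, D S /\ nrm (u k - S) <= d.
  move=> k; have [S DS hS] := weakly_dense_nrm hdot htau DM D0 Dlin qD qr (u k) d0.
  by exists S.
have rx k : right_covered P (x k) by have [[_ ?] _] := hx k.
pose m0 k := sval (cid (rx k)); pose g k := sval (cid (svalP (cid (rx k)))).
have gP k := svalP (cid (svalP (cid (rx k)))).
have [m hm] := @module_support _ _ _ hdot _ _ hM hP PM _ htau _ m0 x g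
  (fun k => (gP k).1) (fun k => (gP k).2).
(* [m.+1] keeps the weight positive when [m = 0]. *)
have [c c0 cm] : exists2 c : R, 0 < c & c * m%:R <= 8^-1.
  exists (8 * m.+1%:R)^-1; first by rewrite invr_gt0 mulr_gt0.
  rewrite invfM -mulrA ler_piMr ?invr_ge0 // mulrC ler_pdivrMr // mul1r ler_nat.
  exact: leqnSn.
(* With pieces of trace at most [c / 8], the inequality [c * tr (z i) < tr (f i)] will give
   [tr (z i) <= 1/8]. *)
have [|r [f [pf f0 fs fsum]]] := diffuse_partition hdot hM hP PM htau diffP (s := c / 8).
  by rewrite divr_gt0.
have sf i : vn_star hdot (f i) = f i by have [_ ? _] := pf i.
have ff i : f i * f i = f i by have [_ _ ?] := pf i.
have Pf i : P (f i) by have [? _ _] := pf i.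
have e0 : 0 < 128^-1 :> R by rewrite invr_gt0.
have [z [Pz zc tz tzs hz]] := hm r f Pf ff f0 _ e0.
pose E i := \sum_k (nrm (f i * (u k - x k)) + nrm (f i * x k * (1 - z i))).
have Esum : \sum_i E i <= 64^-1.
  have -> : \sum_i E i = \sum_k \sum_i nrm (f i * (u k - x k)) +
      \sum_i \sum_k nrm (f i * x k * (1 - z i)).
    rewrite [X in _ = X + _]exchange_big -big_split /=; apply: eq_bigr => i _.
    by rewrite -big_split.
  have h : \sum_k \sum_i nrm (f i * (u k - x k)) <= 128^-1.
    apply: (@le_trans _ _ (\sum_(k < n) d)).
      apply: ler_sum => k _; apply: le_trans (hx k).2.
      exact: (@vn_nrm_sum_proj _ _ _ hdot _ hM _ htau _ f (u k - x k) sf ff f0).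
    by rewrite sumr_const card_ord -[d *+ n]mulr_natl.
  exact: le_trans (lerD h hz) arith_sum.
(* Pigeonhole: otherwise the traces of the [f i] would sum to less than [1/2]. *)
have [i hi] : exists i, 16 * E i + c * tr (z i) < tr (f i).
  apply: contrapT => hno.
  have : \sum_i tr (f i) <= \sum_i (16 * E i + c * tr (z i)).
    by apply: ler_sum => i _; rewrite leNgt; apply/negP => ?; apply: hno; exists i.
  rewrite big_split /= -!mulr_sumr => /(arith_pick _ _ _ Esum).
  rewrite ltNge fsum => /(_ _)/negP; apply=> //; apply: le_trans cm.
  by rewrite ler_pM2l.
have E0 : 0 <= E i.
  by apply: sumr_ge0 => k _; rewrite addr_ge0 // vn_nrm_ge0.
have tzi : tr (z i) <= 8^-1.
  have : c * tr (z i) < c * 8^-1 := arith_small _ _ _ _ E0 hi (fs i).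
  by rewrite ltr_pM2l // => /ltW.
have cz0 : 0 <= c * tr (z i) by rewrite mulr_ge0 ?(ltW c0).
have tf := arith_pos _ _ _ E0 cz0 hi.
have ffl y : f i * (f i * y) = f i * y by rewrite mulrA ff.
have key k : 5 / 8 * tr (f i) <= tr (f i * (u k * z i * vn_star hdot (u k))).
  pose B := f i * u k; pose C := B * (1 - z i).
  have nB : nrm B = tr (f i).
    rewrite /nrm /vn_nrm /B vn_starM sf -!mulrA ffl vn_trC // -/tr.
    by rewrite -mulrA (uu k).1 mulr1.
  (* Replacing [u k] by [x k] costs at most twice [E i], and [16 * E i < tr (f i)]. *)
  have nC : nrm C <= 8^-1 * tr (f i).
    have -> : C = f i * (u k - x k) * (1 - z i) + f i * x k * (1 - z i).
      by rewrite -mulrDl -mulrDr subrK.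
    have h1 : nrm (f i * (u k - x k) * (1 - z i)) <= nrm (f i * (u k - x k)).
      by apply: vn_nrm_contractionr => //; exact: (zc i).2.
    have h2 : nrm (f i * (u k - x k)) + nrm (f i * x k * (1 - z i)) <= E i.
      rewrite /E (bigD1 k) //= lerDl; apply: sumr_ge0 => l _.
      by rewrite addr_ge0 // vn_nrm_ge0.
    exact: (arith_err _ _ _ _ _ _ (vn_nrmD_le hdot htau _ _) h1 h2 cz0 E0 _ hi).
  have -> : tr (f i * (u k * z i * vn_star hdot (u k))) = nrm B - tr (vn_star hdot B * C).
    rewrite /C mulrBr mulr1 mulrBr /tr vn_trB // opprB addrC subrK.
    by rewrite /B vn_starM sf -!mulrA ffl [RHS]vn_trC // -!mulrA.
  (* The factor [2] bounds the trace of [star B * C] by [1/4 + 1/8 = 3/8] of [tr (f i)]. *)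
  have := vn_nrm_ge0 hdot htau (B - C *+ 2).
  rewrite vn_nrmB // vn_nrmMn // mulrnAr vn_trMn // -/nrm -/tr nB.
  by move/arith_key; apply.
(* Averaging [key] over [k] gives [5/8 <= tr (z i) + 1/4], although [tr (z i) <= 1/8]. *)
have := bound (z i) (Pz i) (zc i).1 (f i) (sf i) (ff i).
have : \sum_(k < n) (5 / 8 * tr (f i)) <= \sum_k tr (f i * (u k * z i * vn_star hdot (u k))).
  exact: ler_sum.
rewrite sumr_const card_ord -[_ *+ n]mulr_natl => h1 h2.
have := le_trans h1 h2; rewrite ler_pM2l // -/tr => h3.
have h4 : tr (z i) * tr (f i) <= 8^-1 * tr (f i) by rewrite ler_pM2r.
exact: (arith_end _ _ tf h4 h3).
Qed.
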